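(* In the setting below, the global scattering operator $\mathrm{S}:G_h\to G_h$ satisfies $\|\mathrm{S}(g)\|<\|g\|$ for all $g\in G_h\setminus\{0\}$.
   Context: $\Omega\subset\mathbb{R}^d$ ($d=2,3$) is a Lipschitz polytopal domain with a conforming simplicial mesh $\mathcal{T}_h$; $\mathcal{F}_K$ is the set of faces of $K\in\mathcal{T}_h$. Fix $\mathrm{p}\ge0$; $\kappa$ and $\eta$ are strictly positive real coefficients constant on each element, with values $\kappa_K,\eta_K$ on $K$. $\mathcal{P}_\mathrm{p}(\cdot)$, $\boldsymbol{\mathcal{P}}_\mathrm{p}(\cdot)$ are spaces of complex scalar/$\mathbb{C}^d$-valued polynomials of degree $\le\mathrm{p}$; $(u,v)_K:=\int_K u\overline{v}$, $\langle u,v\rangle_F:=\int_F u\overline{v}$; $\mathbf{n}_{K,F}$ is the unit normal on $F$ outward from $K$. For each face $F$ of the mesh, $\mathcal{A}_F:\mathcal{P}_\mathrm{p}(F)\to\mathcal{P}_\mathrm{p}(F)$ is a linear operator (depending only on $F$, not on the adjacent element), self-adjoint for $\langle\cdot,\cdot\rangle_F$ and positive ($\langle\mathcal{A}_F\phi,\phi\rangle_F>0$ for $\phi\neq0$); $\|u\|_F:=\sqrt{\langle\mathcal{A}_F u,u\rangle_F}$. Let $G_h:=\prod_{K\in\mathcal{T}_h}\prod_{F\in\mathcal{F}_K}\mathcal{P}_\mathrm{p}(F)$ (one component $g_{K,F}$ per face of each element) with norm $\|g\|:=\big(\sum_{K}\sum_{F\in\mathcal{F}_K}\|g_{K,F}\|_F^2\big)^{1/2}$.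 For $g\in G_h$ and each $K$, let $(p_K,\mathbf{u}_K)\in\mathcal{P}_\mathrm{p}(K)\times\boldsymbol{\mathcal{P}}_\mathrm{p}(K)$ be the unique solution of: for all $(q_K,\mathbf{v}_K)$ in the same space, $$-\imath(\kappa_K\eta_K^{-1}p_K,q_K)_K-(\mathbf{u}_K,\nabla q_K)_K+\sum_{F\in\mathcal{F}_K}\tfrac12\langle\mathcal{A}_F^{-1}p_K+\mathbf{n}_{K,F}\cdot\mathbf{u}_K,q_K\rangle_F=\sum_{F\in\mathcal{F}_K}\tfrac12\langle g_{K,F},q_K\rangle_F,$$ $$-\imath(\kappa_K\eta_K\mathbf{u}_K,\mathbf{v}_K)_K-(p_K,\nabla\cdot\mathbf{v}_K)_K+\sum_{F\in\mathcal{F}_K}\tfrac12\langle p_K+\mathcal{A}_F(\mathbf{n}_{K,F}\cdot\mathbf{u}_K),\mathbf{n}_{K,F}\cdot\mathbf{v}_K\rangle_F=-\sum_{F\in\mathcal{F}_K}\tfrac12\langle\mathcal{A}_F g_{K,F},\mathbf{n}_{K,F}\cdot\mathbf{v}_K\rangle_F.$$ The scattering operator is $\mathrm{S}(g)|_{K,F}:=\mathcal{A}_F^{-1}p_K|_F+\mathbf{n}_{K,F}\cdot\mathbf{u}_K|_F$. *)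

(* Defs.v *)
From HB Require Import structures.
From mathcomp Require Import all_boot all_order all_algebra.
From mathcomp Require Import complex.
From mathcomp Require Import mpoly.
From mathcomp Require Import all_classical all_reals all_analysis.

Set Implicit Arguments.
Unset Strict Implicit.
Unset Printing Implicit Defensive.
Import Order.TTheory GRing.Theory Num.Theory.
Import numFieldNormedType.Exports.
Local Open Scope classical_set_scope.
Local Open Scope ring_scope.

Notation CPoly R n := (mpoly.mpoly n.+1 (complex R)).

Section HDG.
Context {R : realType} {n : nat}.
Local Notation d := n.+1.
Local Notation point := 'rV[R]_d.
Local Notation C := R[i].

Local Notation CPoly := (mpoly.mpoly d C).

Definition degle (p : nat) (q : CPoly) : Prop := (msize q <= p.+1)%N.

Definition ev (q : CPoly) (x : point) : C :=
  mpoly.meval (fun j => real_complex R (x 0 j)) q.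

Definition dpoly (j : 'I_d) (q : CPoly) : CPoly := mpoly.mderiv j q.
Definition divpoly (v : 'I_d -> CPoly) : CPoly := \sum_j mpoly.mderiv j (v j).

Definition ndot (nu : point) (u : 'I_d -> CPoly) : CPoly :=
  \sum_j (real_complex R (nu 0 j)) *: u j.

Definition dot (x y : point) : R := \sum_j x 0 j * y 0 j.

(* Lebesgue integral over the scaled reference simplex
   { t in R^m | t_j >= 0, sum_j t_j <= c }, by Fubini (iterated integrals) *)
Fixpoint simint (m : nat) : R -> ('rV[R]_m -> R) -> R :=
  match m with
  | 0 => fun _ f => f 0
  | m'.+1 => fun c f =>
      Rintegral (@lebesgue_measure R) `[0, c]
        (fun s : R => @simint m' (c - s)
                    (fun t : 'rV[R]_m' => f (row_mx (const_mx s : 'rV[R]_1) t)))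
  end.

Definition edges (m : nat) (b : 'I_m.+1 -> point) : 'M[R]_(m, d) :=
  \matrix_(i < m, j < d) (b (lift ord0 i) 0 j - b ord0 0 j).

(* integral w.r.t. m-dimensional (Hausdorff/Lebesgue) measure over the
   m-simplex with vertices b, via the area formula for the affine
   parametrization t |-> b_0 + t B *)
Definition affint (m : nat) (b : 'I_m.+1 -> point) (f : point -> R) : R :=
  Num.sqrt (\det (edges b *m (edges b)^T)) *
  @simint m 1 (fun t => f (b ord0 + t *m edges b)).

Definition cint (m : nat) (b : 'I_m.+1 -> point) (f : point -> C) : C :=
  Complex (affint b (fun x => complex.Re (f x))) (affint b (fun x => complex.Im (f x))).

Definition hull (m : nat) (b : 'I_m -> point) : set point :=
  [set x | exists lam : 'I_m -> R, (forall j, 0 <= lam j) /\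
      \sum_j lam j = 1 /\ x = \sum_j lam j *: b j].

Definition hullset (S : set point) : set point :=
  [set x | exists (m : nat) (b : 'I_m -> point) (lam : 'I_m -> R),
      (forall j, S (b j)) /\ (forall j, 0 <= lam j) /\
      \sum_j lam j = 1 /\ x = \sum_j lam j *: b j].

(* A d-simplex is given by its d+1 vertices a : 'I_d.+1 -> point;
   its i-th face is the face opposite to vertex i *)
Definition facev (a : 'I_d.+1 -> point) (i : 'I_d.+1) : 'I_d -> point :=
  fun j => a (lift i j).
Definition faceset (a : 'I_d.+1 -> point) (i : 'I_d.+1) : set point :=
  hull (facev a i).

Definition nondegenerate (a : 'I_d.+1 -> point) : Prop :=
  \det (edges a) != 0.

Definition ipK (a : 'I_d.+1 -> point) (f g : point -> C) : C :=
  cint a (fun x => f x * conjc (g x)).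
Definition ipKv (a : 'I_d.+1 -> point) (f g : 'I_d -> point -> C) : C :=
  cint a (fun x => \sum_j f j x * conjc (g j x)).
Definition ipF (a : 'I_d.+1 -> point) (i : 'I_d.+1) (f g : point -> C) : C :=
  cint (facev a i) (fun x => f x * conjc (g x)).

(* equality as elements of P_p(F) (i.e. of the restrictions to F) *)
Definition eqon (S : set point) (phi psi : CPoly) : Prop :=
  forall x, S x -> ev phi x = ev psi x.

Definition unit_outward_normal (a : 'I_d.+1 -> point) (i : 'I_d.+1)
    (nu : point) : Prop :=
  dot nu nu = 1 /\
  (forall j k : 'I_d, dot nu (a (lift i j) - a (lift i k)) = 0) /\
  dot nu (a i - a (lift i ord0)) < 0.

(* Hypotheses on the face operator A_F : P_p(F) -> P_p(F) (with inverse
   Ainv_F), F being face i of the simplex a.  Operators are indexed by the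
   face F as a subset of R^d, hence depend only on F. *)
Definition face_operator (p : nat) (A Ainv : set point -> CPoly -> CPoly)
    (a : 'I_d.+1 -> point) (i : 'I_d.+1) : Prop :=
  let F := faceset a i in
  (forall phi, degle p phi -> degle p (A F phi) /\ degle p (Ainv F phi)) /\
  (forall phi psi, degle p phi -> degle p psi -> eqon F phi psi ->
     eqon F (A F phi) (A F psi)) /\
  (forall (c : C) phi psi, degle p phi -> degle p psi ->
     eqon F (A F (c *: phi + psi)) (c *: A F phi + A F psi)) /\
  (forall phi psi, degle p phi -> degle p psi ->
     ipF a i (ev (A F phi)) (ev psi) = ipF a i (ev phi) (ev (A F psi))) /\
  (forall phi, degle p phi -> ~ eqon F phi 0 ->
     0 < ipF a i (ev (A F phi)) (ev phi)) /\
  (forall phi, degle p phi ->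
     eqon F (A F (Ainv F phi)) phi /\ eqon F (Ainv F (A F phi)) phi).

Definition local_solution (p : nat) (A Ainv : set point -> CPoly -> CPoly)
    (a : 'I_d.+1 -> point) (kappa eta : R) (nu : 'I_d.+1 -> point)
    (g : 'I_d.+1 -> CPoly) (pK : CPoly) (uK : 'I_d -> CPoly) : Prop :=
  degle p pK /\ (forall j, degle p (uK j)) /\
  (forall q : CPoly, degle p q ->
     - ('i%C * ipK a (fun x => real_complex R (kappa / eta) * ev pK x) (ev q))
     - ipKv a (fun j => ev (uK j)) (fun j => ev (dpoly j q))
     + \sum_i 2^-1 * ipF a i
              (ev (Ainv (faceset a i) pK + ndot (nu i) uK)) (ev q)
     = \sum_i 2^-1 * ipF a i (ev (g i)) (ev q)) /\
  (forall v : 'I_d -> CPoly, (forall j, degle p (v j)) ->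
     - ('i%C * ipKv a (fun j x => real_complex R (kappa * eta) * ev (uK j) x)
                     (fun j => ev (v j)))
     - ipK a (ev pK) (ev (divpoly v))
     + \sum_i 2^-1 * ipF a i
              (ev (pK + A (faceset a i) (ndot (nu i) uK))) (ev (ndot (nu i) v))
     = - \sum_i 2^-1 * ipF a i
              (ev (A (faceset a i) (g i))) (ev (ndot (nu i) v))).

Definition Gnorm {E : finType} (A : set point -> CPoly -> CPoly)
    (a : E -> 'I_d.+1 -> point) (g : E -> 'I_d.+1 -> CPoly) : R :=
  Num.sqrt (\sum_K \sum_i
     complex.Re (ipF (a K) i (ev (A (faceset (a K) i) (g K i))) (ev (g K i)))).

Definition conforming {E : finType} (a : E -> 'I_d.+1 -> point) : Prop :=
  forall K K' : E, K != K' ->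
    hull (a K) != hull (a K') /\
    hull (a K) `&` hull (a K') =
      hullset [set x | (exists i, x = a K i) /\ (exists j, x = a K' j)].

Definition lipschitz_domain (Om : set point) : Prop :=
  open Om /\ connected Om /\ bounded_set Om /\
  forall x, closure Om x -> ~ Om x ->
    exists r : R, 0 < r /\
    exists Q : 'M[R]_d, Q *m Q^T = 1%:M /\
    exists (gam : 'rV[R]_n -> R) (L : R),
      (forall y z, `|gam y - gam z| <= L * `|y - z|) /\
      forall y : point, `|y - x| < r ->
        (Om y <-> ((y - x) *m Q) 0 ord_max <
                  gam (\row_(j < n) ((y - x) *m Q) 0 (widen_ord (leqnSn n) j))).

Definition simplicial_mesh {E : finType} (Om : set point)
    (a : E -> 'I_d.+1 -> point) : Prop :=
  (forall K, nondegenerate (a K)) /\ conforming a /\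
  closure Om = \bigcup_(K in [set: E]) hull (a K).

End HDG.

(* Main.v *)
Require Import Defs.
From HB Require Import structures.
From mathcomp Require Import all_boot all_order all_algebra.
From mathcomp Require Import complex.
From mathcomp Require Import ssrcomplements mpoly.
From mathcomp Require Import all_classical all_reals all_analysis.
From mathcomp Require Import ring lra zify.
Set Implicit Arguments.
Unset Strict Implicit.
Unset Printing Implicit Defensive.
Import Order.TTheory GRing.Theory Num.Theory.
Import numFieldNormedType.Exports.
Local Open Scope classical_set_scope.
Local Open Scope ring_scope.

(** On an element [K] write [B(phi, psi) = Re <A phi, psi>_F], [w = n . u],
    [s = A^-1 p + w] (the outgoing trace) and [r = A^-1 p - w].  Testing the
    local problem with its own solution and using the divergence theorem, the
    real parts add up to [sum_F B(s, s) + B(g - r, g - r) = sum_F B(g, g)].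
    Hence scattering never increases the norm, and equality forces [g = r] on
    every face of [K].  Substituting this back and integrating by parts, the
    solution satisfies [div u = i (kappa / eta) p] and
    [grad p = i kappa eta u] exactly, so [p] is a polynomial eigenfunction of
    the Laplacian with eigenvalue [- kappa^2 <> 0]; by degree [p = 0], then
    [u = 0] and [g = 0].

    The divergence theorem for polynomials on a simplex is reduced to the
    reference simplex, where both sides are computed on monomials with
    Dirichlet's formula
    [int (c - sum t)^e t^al = e! al! / (e + |al| + m)! c^(e + |al| + m)]. *)

(** * Integration of polynomials on the reference simplex *)

Section Univariate.
Context {R : realType}.

Lemma Rintegral_deriv_poly (P : {poly R}) (a b : R) : a <= b ->
  Rintegral (@lebesgue_measure R) `[a, b] (fun x => P^`().[x]) = P.[b] - P.[a].
Proof.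
rewrite le_eqVlt => /orP[/eqP <-|ab].
  by rewrite set_itv1 Rintegral_set1 subrr.
rewrite /Rintegral (@continuous_FTC2 _ _ (horner P)) //.
- by apply/continuous_subspaceT => x; exact: continuous_horner.
- split=> [x _||].
  + exact: derivable_horner.
  + by apply: cvg_at_right_filter; exact: continuous_horner.
  + by apply: cvg_at_left_filter; exact: continuous_horner.
- by move=> x _; rewrite -derivE.
Qed.

(** Euler's Beta integral, by induction on [k] with [N] free: differentiating
    [X^(k+1) (c - X)^(N+1)] links the exponents [(k+1, N)] to [(k, N+1)], which is integration by
    parts. An explicit primitive lets the fundamental theorem of calculus apply directly. *)
Lemma beta_antiderivative (c : R) (k N : nat) :
  exists P : {poly R}, P^`() = 'X^k * (c%:P - 'X) ^+ N /\
    P.[c] - P.[0] = (k`! * N`!)%:R / (k + N).+1`!%:R * c ^+ (k + N).+1.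
Proof.
have dX N' : ((c%:P - 'X) ^+ N'.+1)^`() = - (N'.+1%:R *: (c%:P - 'X) ^+ N') :> {poly R}.
  by rewrite deriv_exp derivB derivC derivX sub0r mulN1r mulNrn scaler_nat.
have nz n : n.+1%:R != 0 :> R by rewrite pnatr_eq0.
have fz n : n`!%:R != 0 :> R by rewrite pnatr_eq0 -lt0n fact_gt0.
elim: k N => [|k IH] N.
  exists (- (N.+1%:R^-1 *: (c%:P - 'X) ^+ N.+1)); split.
    by rewrite derivN derivZ dX scalerN opprK scalerA mulVf // scale1r expr0 mul1r.
  rewrite !(hornerE, horner_exp) subrr expr0n /= mulr0 oppr0 sub0r opprK addr0.
  by rewrite factS natrM invfM [_ * (_ * _)]mulrCA divff // mulr1.
have [P [dP vP]] := IH N.+1.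
exists (N.+1%:R^-1 *: (k.+1%:R *: P - 'X^(k.+1) * (c%:P - 'X) ^+ N.+1)); split.
  rewrite derivZ derivB derivZ derivM dP derivXn dX /= mulrN -scalerAr -['X^k *+ _]scaler_nat -scalerAl.
  by rewrite opprD opprK addrA subrr add0r scalerA mulVf // scale1r.
have z j : 0 ^+ j.+1 = 0 :> R by rewrite exprS mul0r.
rewrite addSnnS; move: (fz (k + N.+1).+1) vP; move: (_`!%:R) (c ^+ (_ + _).+1) => D E D0 vP.
rewrite !(hornerE, horner_exp) subrr !z mulr0 mul0r !subr0.
rewrite -mulrBr -mulrBr vP (factS k) (factS N) !natrM.
by field; rewrite D0 addrC natr1 nz.
Qed.

(** The points [r / (k + 1)] are pairwise distinct, so [u] would have too many roots. For [r > 0]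
    they all lie in []0, r]], so a one-sided neighbourhood of [0] suffices to test for zero. *)
Lemma poly_vanish_harmonic (F : numFieldType) (u : {poly F}) (r : F) : r != 0 ->
  (forall k : nat, u.[r / k.+1%:R] = 0) -> u = 0.
Proof.
move=> r0 hu; apply/eqP; apply: contraT => u0.
have := @max_poly_roots _ u (mkseq (fun k : nat => r / k.+1%:R) (size u)) u0.
rewrite size_mkseq ltnn => -> //.
- by apply/allP => x /mapP[k _ ->]; rewrite rootE hu.
- apply/mkseq_uniqP => i j _ _ /(mulfI r0) /invr_inj /eqP.
  by rewrite eqr_nat eqSS => /eqP.
Qed.

(** [P] is nondecreasing on [[0, c]] with equal end values, hence constant there; [P - P(0)] then
    has infinitely many roots. *)
Lemma nonneg_Rintegral_eq0 (P : {poly R}) (c : R) : 0 < c ->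
  (forall s, 0 <= s <= c -> 0 <= P^`().[s]) -> P.[c] = P.[0] -> P^`() = 0.
Proof.
move=> c0 hP e.
have mono a b : 0 <= a -> a <= b -> b <= c -> P.[a] <= P.[b].
  move=> a0 ab bc; rewrite -subr_ge0 -Rintegral_deriv_poly //.
  apply: Rintegral_ge0 => x /=; rewrite in_itv /= => /andP[ax xb].
  by apply: hP; lra.
suff -> : P = (P.[0])%:P by rewrite derivC.
apply/eqP; rewrite -subr_eq0; apply/eqP; apply: (@poly_vanish_harmonic _ _ c).
  by rewrite gt_eqF.
move=> k; rewrite !hornerE.
have k0 : 0 <= c / k.+1%:R by rewrite divr_ge0 // ltW.
have kc : c / k.+1%:R <= c.
  by rewrite ler_pdivrMr ?ltr0n // ler_peMr ?ler1n // ltW.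
apply/eqP; rewrite subr_eq0 eq_le; apply/andP; split; last exact: mono.
by rewrite -e; apply: mono.
Qed.

End Univariate.

(** * Dirichlet's formula by slicing the simplex *)

Section Simplex.
Context {R : realType}.

(** Dirichlet's integral over the unit simplex; [e] is the exponent of the slack [1 - sum t], the
    barycentric coordinate of the vertex at the origin. *)
Definition dirichlet (m e : nat) (al : 'I_m -> nat) : R :=
  (e`! * \prod_j (al j)`!)%:R / (e + \sum_j al j + m)`!%:R.

Lemma row_mx_cons0 m (s : R) (t : 'rV[R]_m) :
  (row_mx (const_mx s : 'rV[R]_1) t : 'rV[R]_m.+1) 0 ord0 = s.
Proof.
by rewrite mxE; case: splitP => j //=; rewrite mxE.
Qed.

Lemma row_mx_consS m (s : R) (t : 'rV[R]_m) (j : 'I_m) :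
  (row_mx (const_mx s : 'rV[R]_1) t : 'rV[R]_m.+1) 0 (lift ord0 j) = t 0 j.
Proof.
rewrite mxE; case: splitP => [i|i [/val_inj ->]] //.
by case: i => [[|]].
Qed.

Lemma eq_simint m (c : R) (f g : 'rV[R]_m -> R) : 0 <= c ->
  (forall t : 'rV[R]_m, (forall j, 0 <= t 0 j) -> \sum_j t 0 j <= c -> f t = g t) ->
  simint c f = simint c g.
Proof.
elim: m c f g => [|m IH] c f g c0 fg /=.
  by apply: fg => [[]//|]; rewrite big_ord0.
apply: eq_Rintegral => s; rewrite inE /= in_itv /= => /andP[s0 sc].
apply: IH; first by rewrite subr_ge0.
move=> t t0 tc; apply: fg => [j|].
  by case: (unliftP ord0 j) => [j' ->|->]; rewrite ?row_mx_cons0 ?row_mx_consS.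
rewrite big_ord_recl row_mx_cons0.
under eq_bigr do rewrite row_mx_consS.
lra.
Qed.

Lemma simint_ge0 m (c : R) (f : 'rV[R]_m -> R) : 0 <= c ->
  (forall t : 'rV[R]_m, (forall j, 0 <= t 0 j) -> \sum_j t 0 j <= c -> 0 <= f t) ->
  0 <= simint c f.
Proof.
elim: m c f => [|m IH] c f c0 f0 /=.
  by apply: f0 => [[]//|]; rewrite big_ord0.
apply: Rintegral_ge0 => s /=; rewrite in_itv /= => /andP[s0 sc].
apply: IH; first by rewrite subr_ge0.
move=> t t0 tc; apply: f0 => [j|].
  by case: (unliftP ord0 j) => [j' ->|->]; rewrite ?row_mx_cons0 ?row_mx_consS.
rewrite big_ord_recl row_mx_cons0.
under eq_bigr do rewrite row_mx_consS.
lra.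
Qed.

(** Linearity is carried by the primitives, so integrating a finite sum calls for no integrability
    argument. *)
Lemma beta_sum_antiderivative (T : Type) (r : seq T) (c : R) (k : T -> R) (a N : T -> nat) :
  exists P : {poly R},
    (forall s, P^`().[s] = \sum_(x <- r) k x * (s ^+ a x * (c - s) ^+ N x)) /\
    P.[c] - P.[0] = \sum_(x <- r) k x * (((a x)`! * (N x)`!)%:R
                      / (a x + N x).+1`!%:R * c ^+ (a x + N x).+1).
Proof.
elim: r => [|x r [P [dP vP]]].
  by exists 0; split => [s|]; rewrite big_nil ?deriv0 !horner0 ?subrr.
have [Q [dQ vQ]] := beta_antiderivative c (a x) (N x).
exists (k x *: Q + P); split => [s|].
  by rewrite derivD derivZ !hornerE dP dQ big_cons !(hornerE, horner_exp).
by rewrite !hornerE big_cons -vP -vQ; ring.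
Qed.

Definition dirichlet_sum {m} {T : Type} (r : seq T) (k : T -> R) (e : T -> nat)
  (al : T -> 'I_m -> nat) (c : R) (t : 'rV[R]_m) : R :=
  \sum_(x <- r) k x * ((c - \sum_j t 0 j) ^+ e x * \prod_j t 0 j ^+ al x j).

Lemma dirichlet_sum_cons m (T : Type) (r : seq T) (k : T -> R) (e : T -> nat)
    (al : T -> 'I_m.+1 -> nat) (c s : R) (t : 'rV[R]_m) :
  dirichlet_sum r k e al c (row_mx (const_mx s : 'rV[R]_1) t) =
  dirichlet_sum r (fun x => k x * s ^+ al x ord0) e
    (fun x j => al x (lift ord0 j)) (c - s) t.
Proof.
apply: eq_bigr => x _; rewrite !big_ord_recl row_mx_cons0.
rewrite (eq_bigr (fun j => t 0 j)) => [|j _]; last by rewrite row_mx_consS.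
rewrite [X in _ * (_ * (_ * X))](eq_bigr (fun j => t 0 j ^+ al x (lift ord0 j))).
  by rewrite opprD addrA; ring.
by move=> j _; rewrite row_mx_consS.
Qed.

(* The slice at height [s] of the integral of a Dirichlet sum is again a
   sum of terms [s ^ a (c - s) ^ N], which keeps the induction going. *)
Lemma simint_dirichlet m (T : Type) (r : seq T) (k : T -> R) (e : T -> nat)
    (al : T -> 'I_m -> nat) (c : R) : 0 <= c ->
  simint c (dirichlet_sum r k e al c) =
  \sum_(x <- r) k x * (dirichlet (e x) (al x) * c ^+ (e x + \sum_j al x j + m)).
Proof.
elim: m k e al c => [|m IH] k e al c c0 /=.
  rewrite /dirichlet_sum; apply: eq_bigr => x _; rewrite /dirichlet !big_ord0 subr0 muln1 !addn0.
  by rewrite divff ?pnatr_eq0 -?lt0n ?fact_gt0 // mul1r mulr1.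
pose N x := (e x + \sum_(j < m) al x (lift ord0 j) + m)%N.
pose w x := dirichlet (e x) (fun j => al x (lift ord0 j)).
have [P [dP vP]] := beta_sum_antiderivative r c (fun x => k x * w x) (fun x => al x ord0) N.
transitivity (Rintegral (@lebesgue_measure R) `[0, c] (fun s => P^`().[s])).
  apply: eq_Rintegral => s; rewrite inE /= in_itv /= => /andP[s0 sc].
  under eq_fun do rewrite dirichlet_sum_cons.
  rewrite IH ?subr_ge0 // dP; apply: eq_bigr => x _.
  by rewrite -/(w x) -/(N x); ring.
rewrite Rintegral_deriv_poly // vP; apply: eq_bigr => x _.
rewrite /w /dirichlet -/(N x) !big_ord_recl.
have -> : (e x + (al x ord0 + \sum_(i < m) al x (lift ord0 i)) + m.+1 = (al x ord0 + N x).+1)%N.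
  by rewrite /N; lia.
have fz n : n`!%:R != 0 :> R by rewrite pnatr_eq0 -lt0n fact_gt0.
move: (fz (al x ord0 + N x).+1) (fz (N x)).
move: ((al x ord0 + N x).+1`!%:R) (c ^+ (al x ord0 + N x).+1) => D Ec D0 D'0.
rewrite !natrM.
by field; rewrite D0 D'0.
Qed.

(** Induction on the dimension: the integral of the slice at height [s] is a polynomial in [s],
    nonnegative on [[0, c]] and of zero integral. It is therefore zero, and the induction hypothesis
    applies to each slice. *)
Lemma simint_dirichlet_eq0 m (T : Type) (r : seq T) (k : T -> R) (e : T -> nat)
    (al : T -> 'I_m -> nat) (c : R) : 0 < c ->
  (forall t : 'rV[R]_m, (forall j, 0 <= t 0 j) -> \sum_j t 0 j <= c ->
     0 <= dirichlet_sum r k e al c t) ->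
  simint c (dirichlet_sum r k e al c) = 0 ->
  forall t : 'rV[R]_m, (forall j, 0 <= t 0 j) -> \sum_j t 0 j < c ->
    dirichlet_sum r k e al c t = 0.
Proof.
elim: m k e al c => [|m IH] k e al c c0 f0 /=.
  by move=> h t _ _; rewrite (_ : t = 0) //; apply/rowP; case.
pose N x := (e x + \sum_(j < m) al x (lift ord0 j) + m)%N.
pose w x := dirichlet (e x) (fun j => al x (lift ord0 j)).
have [P [dP _]] := beta_sum_antiderivative r c (fun x => k x * w x) (fun x => al x ord0) N.
have slice s : 0 <= s <= c -> simint (c - s)
    (fun t => dirichlet_sum r k e al c (row_mx (const_mx s : 'rV[R]_1) t)) = P^`().[s].
  move=> /andP[s0 sc].
  under eq_fun do rewrite dirichlet_sum_cons.
  rewrite simint_dirichlet ?subr_ge0 // dP; apply: eq_bigr => x _.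
  by rewrite -/(w x) -/(N x); ring.
have f0s s : 0 <= s <= c -> forall t : 'rV[R]_m, (forall j, 0 <= t 0 j) -> \sum_j t 0 j <= c - s ->
    0 <= dirichlet_sum r k e al c (row_mx (const_mx s : 'rV[R]_1) t).
  move=> /andP[s0 sc] t t0 tc; apply: f0 => [j|].
    by case: (unliftP ord0 j) => [j' ->|->]; rewrite ?row_mx_cons0 ?row_mx_consS.
  rewrite big_ord_recl row_mx_cons0.
  under eq_bigr do rewrite row_mx_consS.
  lra.
move=> int0.
have Pc : P.[c] = P.[0].
  apply: subr0_eq; rewrite -Rintegral_deriv_poly ?(ltW c0) // -[RHS]int0.
  by apply: eq_Rintegral => s; rewrite inE /= in_itv /= => hs; rewrite slice.
have dP0 : P^`() = 0.
  apply: (@nonneg_Rintegral_eq0 _ P c) => // s hs; rewrite -slice //.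
  by apply: simint_ge0; [lra|exact: f0s].
move=> t t0 tc.
pose s := t 0 ord0; pose t' : 'rV[R]_m := \row_j t 0 (lift ord0 j).
have tE : t = row_mx (const_mx s : 'rV[R]_1) t'.
  apply/rowP => j; case: (unliftP ord0 j) => [j' ->|->].
    by rewrite row_mx_consS mxE.
  by rewrite row_mx_cons0.
have sumE : \sum_j t 0 j = s + \sum_j t' 0 j.
  by rewrite big_ord_recl; congr (_ + _); apply: eq_bigr => j _; rewrite mxE.
have t'0 j : 0 <= t' 0 j by rewrite mxE.
have t's : 0 <= \sum_j t' 0 j by apply: sumr_ge0.
have s0 : 0 <= s by apply: t0.
(* The strict bound on the sum of [t] leaves a slice of positive size [c - s], as the induction
   hypothesis requires. *)
rewrite tE dirichlet_sum_cons; apply: IH => //; try lra.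
  by move=> t1 h1 h2; rewrite -dirichlet_sum_cons; apply: f0s => //; lra.
have := slice s; rewrite dP0 horner0.
under eq_fun do rewrite dirichlet_sum_cons.
by apply; lra.
Qed.

End Simplex.

(** * Complex polynomials *)

Section Chain.
Context (n : nat) (C S : comNzRingType) (h : {rmorphism C -> S}) (f : 'I_n -> S).
Context (D : {additive S -> S}).
Context (DM : forall x y, D (x * y) = D x * y + x * D y) (Dh : forall c, D (h c) = 0).

(** Holds for any derivation [D] killing constants: the identity is true for variables, stable under
    products, hence true for monomials, and extends by linearity. It serves both for univariate
    restrictions and for affine substitutions. *)
Lemma mmap_chain_rule (P : {mpoly C[n]}) :
  D (mmap h f P) = \sum_j mmap h f (mderiv j P) * D (f j).
Proof.
pose T (P : {mpoly C[n]}) := D (mmap h f P) = \sum_j mmap h f (mderiv j P) * D (f j).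
have T1 : T 1.
  rewrite /T rmorph1 -(rmorph1 h) Dh big1 // => j _.
  by rewrite -mpolyC1 mderivC raddf0 mul0r.
have TM P1 P2 : T P1 -> T P2 -> T (P1 * P2).
  rewrite /T rmorphM DM => -> ->; rewrite mulr_suml mulr_sumr -big_split.
  apply: eq_bigr => j _; rewrite mderivM rmorphD !rmorphM /=; ring.
have TX i : T 'X_i.
  rewrite /T mmapX mmap1U (bigD1 i) //= big1 ?addr0 => [|j ji].
    rewrite mderivX mnm1E eqxx scale1r (_ : (U_(i) - U_(i))%MM = 0%MM).
      by rewrite mpolyX0 rmorph1 mul1r.
    by apply/mnmP => j; rewrite mnmBE subnn mnm0E.
  by rewrite mderivX mnm1E eq_sym (negbTE ji) scale0r raddf0 mul0r.
elim/mpolyind: P => [|c m p _ _ IH]; rewrite -/(T _).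
  by rewrite /T raddf0 raddf0 big1 // => j _; rewrite !raddf0 mul0r.
have TXm : T 'X_[m].
  rewrite mpolyXE_id; elim/big_ind: _ => // i _.
  by elim: (m i) => [|k IHk]; rewrite ?expr0 // exprS; apply: TM.
have Dc x : D (h c * x) = h c * D x by rewrite DM Dh mul0r add0r.
rewrite /T raddfD /= mmapZ raddfD /= Dc TXm IH mulr_sumr -big_split.
apply: eq_bigr => j _; rewrite linearP /= raddfD /= mmapZ; ring.
Qed.

End Chain.

(** * Complex polynomials on the unit simplex: linearity, conjugation, definiteness *)

Section ComplexSimplex.
Context {R : realType}.
Local Notation C := R[i].
Local Open Scope complex_scope.

Definition evalR m (P : {mpoly C[m]}) (t : 'rV[R]_m) : C :=
  P.@[fun j => (t 0 j)%:C].

Definition simC m (f : 'rV[R]_m -> C) : C :=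
  simint 1 (fun t => complex.Re (f t)) +i* simint 1 (fun t => complex.Im (f t)).

Fact conjP_key : unit. Proof. by []. Qed.

Definition conjP m (P : {mpoly C[m]}) : {mpoly C[m]} :=
  locked_with conjP_key (map_mpoly (@conjc R) P).

Lemma complexEta (z : C) : complex.Re z +i* complex.Im z = z.
Proof. by case: z. Qed.

Lemma conjcD (x y : C) : conjc (x + y) = conjc x + conjc y.
Proof. exact: (rmorphD (@conjc R)). Qed.

Lemma conjcM (x y : C) : conjc (x * y) = conjc x * conjc y.
Proof. exact: (rmorphM (@conjc R)). Qed.

Lemma conjc_sum (T : Type) (r : seq T) (F : T -> C) :
  conjc (\sum_(x <- r) F x) = \sum_(x <- r) conjc (F x).
Proof. exact: (big_morph (@conjc R) conjcD (conjc0 R)). Qed.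

Lemma Re_sum (T : Type) (r : seq T) (F : T -> C) :
  complex.Re (\sum_(x <- r) F x) = \sum_(x <- r) complex.Re (F x).
Proof. by apply: (big_morph (@complex.Re R)) => // -[? ?] [? ?]. Qed.

Lemma Im_sum (T : Type) (r : seq T) (F : T -> C) :
  complex.Im (\sum_(x <- r) F x) = \sum_(x <- r) complex.Im (F x).
Proof. by apply: (big_morph (@complex.Im R)) => // -[? ?] [? ?]. Qed.

Lemma Re_mulr (z : C) (x : R) : complex.Re (z * x%:C) = complex.Re z * x.
Proof. by case: z => a b /=; rewrite mulr0 subr0. Qed.

Lemma Im_mulr (z : C) (x : R) : complex.Im (z * x%:C) = complex.Im z * x.
Proof. by case: z => a b /=; rewrite mulr0 add0r. Qed.

Lemma eq_simC m (f g : 'rV[R]_m -> C) :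
  (forall t : 'rV[R]_m, (forall j, 0 <= t 0 j) -> \sum_j t 0 j <= 1 -> f t = g t) ->
  simC f = simC g.
Proof.
by move=> fg; congr (_ +i* _); apply: eq_simint => // t t0 t1; rewrite fg.
Qed.

Lemma simC_dirichlet m (T : Type) (r : seq T) (k : T -> C) (e : T -> nat)
    (al : T -> 'I_m -> nat) :
  simC (fun t => \sum_(x <- r)
          k x * ((1 - \sum_j t 0 j) ^+ e x * \prod_j t 0 j ^+ al x j)%:C) =
  \sum_(x <- r) k x * (dirichlet (e x) (al x))%:C.
Proof.
rewrite -[RHS]complexEta Re_sum Im_sum; congr (_ +i* _).
  rewrite (_ : (fun t => _) = dirichlet_sum r (fun x => complex.Re (k x)) e al 1).
    rewrite simint_dirichlet //; apply: eq_bigr => x _.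
    by rewrite expr1n mulr1 Re_mulr.
  by apply/funext => t; rewrite Re_sum; apply: eq_bigr => x _; rewrite Re_mulr.
rewrite (_ : (fun t => _) = dirichlet_sum r (fun x => complex.Im (k x)) e al 1).
  rewrite simint_dirichlet //; apply: eq_bigr => x _.
  by rewrite expr1n mulr1 Im_mulr.
by apply/funext => t; rewrite Im_sum; apply: eq_bigr => x _; rewrite Im_mulr.
Qed.

Lemma evalR_mono m (al : 'X_{1..m}) (t : 'rV[R]_m) :
  evalR 'X_[al] t = (\prod_j t 0 j ^+ al j)%:C.
Proof.
rewrite /evalR mevalX rmorph_prod /=; apply: eq_bigr => j _.
by rewrite rmorphXn.
Qed.

(** The trivial factor [(1 - sum t) ^ 0] gives a polynomial the shape to which Dirichlet's formula
    applies. *)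
Lemma evalRE m (P : {mpoly C[m]}) (t : 'rV[R]_m) :
  evalR P t = \sum_(al <- msupp P)
    P@_al * ((1 - \sum_j t 0 j) ^+ 0 * \prod_j t 0 j ^+ al j)%:C.
Proof.
rewrite {1}(mpolyE P) {1}/evalR raddf_sum; apply: eq_bigr => al _.
by rewrite expr0 mul1r /= mevalZ -/(evalR _ t) evalR_mono.
Qed.

Lemma simC_evalR m (P : {mpoly C[m]}) :
  simC (evalR P) = \sum_(al <- msupp P) P@_al * (dirichlet 0 al)%:C.
Proof.
rewrite -(simC_dirichlet _ _ (fun=> 0%N)); apply: eq_simC => t _ _.
exact: evalRE.
Qed.

(** The three supports differ, so all sums are first extended to the monomials of degree below a
    common bound, where the extra coefficients are zero. *)
Lemma msupp_sum_linear m (w : 'X_{1..m} -> C) (c : C) (p q : {mpoly C[m]}) :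
  \sum_(al <- msupp (c *: p + q)) (c *: p + q)@_al * w al =
  c * (\sum_(al <- msupp p) p@_al * w al) + \sum_(al <- msupp q) q@_al * w al.
Proof.
have E k (r : {mpoly C[m]}) : (msize r <= k)%N ->
    \sum_(al <- msupp r) r@_al * w al = \sum_(al : 'X_{1..m < k}) r@_al * w al.
  move=> rk; rewrite (big_mksub ('X_{1..m < k} : subFinType _)) ?msupp_uniq //=; first last.
    by move=> x /msize_mdeg_lt /leq_trans; apply.
  by rewrite big_rmcond //= => j /memN_msupp_eq0 ->; rewrite mul0r.
pose k := maxn (msize (c *: p + q)) (maxn (msize p) (msize q)).
rewrite !(E k) ?leq_max ?leqnn ?orbT // mulr_sumr -big_split /=.
by apply: eq_bigr => al _; rewrite mcoeffD mcoeffZ mulrDl mulrA.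
Qed.

Lemma simC_linear m (c : C) (p q : {mpoly C[m]}) :
  simC (evalR (c *: p + q)) = c * simC (evalR p) + simC (evalR q).
Proof. by rewrite !simC_evalR msupp_sum_linear. Qed.

Lemma evalR_conjP m (P : {mpoly C[m]}) t : evalR (conjP P) t = conjc (evalR P t).
Proof.
rewrite /evalR /conjP unlock; elim/mpolyind: P => [|c al p _ _ IH].
  by rewrite [map_mpoly _ _]raddf0 meval0 conjc0.
have -> : map_mpoly (@conjc R) (c *: 'X_[al] + p) = conjc c *: 'X_[al] + map_mpoly (@conjc R) p.
  by rewrite [LHS]raddfD /= map_mpolyZ map_mpolyX.
rewrite [LHS]mevalD [meval _ (c *: _ + p)]mevalD conjcD IH !mevalZ conjcM.
by rewrite -/(evalR _ t) evalR_mono conjc_real.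
Qed.

Lemma simC_conjP m (P : {mpoly C[m]}) :
  simC (evalR (conjP P)) = conjc (simC (evalR P)).
Proof.
rewrite [in RHS]simC_evalR conjc_sum.
transitivity (simC (fun t => \sum_(al <- msupp P)
   conjc (P@_al) * ((1 - \sum_j t 0 j) ^+ 0 * \prod_j t 0 j ^+ al j)%:C)).
  apply: eq_simC => t _ _; rewrite evalR_conjP evalRE conjc_sum.
  by apply: eq_bigr => al _; rewrite conjcM conjc_real.
rewrite simC_dirichlet; apply: eq_bigr => al _.
by rewrite conjcM conjc_real.
Qed.

(** Restricting [P] to the ray from [t] in direction [j] gives a univariate [U] with infinitely many
    roots; the partial derivative at [t] is [U'(0)]. Only forward steps are taken, since [t] may lie
    on a coordinate face. *)
Lemma evalR_deriv_vanish m (P : {mpoly C[m]}) (j : 'I_m) :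
  (forall t : 'rV[R]_m, (forall i, 0 <= t 0 i) -> \sum_i t 0 i < 1 -> evalR P t = 0) ->
  (forall t : 'rV[R]_m, (forall i, 0 <= t 0 i) -> \sum_i t 0 i < 1 ->
     evalR (mderiv j P) t = 0).
Proof.
move=> hP t t0 t1.
pose f i : {poly C} := ((t 0 i)%:C)%:P + (i == j)%:R *: 'X.
pose U := mmap (@polyC C) f P.
have UE s Q : (mmap (@polyC C) f Q).[s%:C] =
    evalR Q (\row_i (t 0 i + (i == j)%:R * s)).
  rewrite /evalR /mmap mevalE -horner_evalE raddf_sum /=; apply: eq_bigr => al _.
  rewrite /horner_eval hornerM hornerC; congr (_ * _).
  rewrite /mmap1 horner_prod; apply: eq_bigr => i _.
  by rewrite horner_exp /f mxE !hornerE rmorphD rmorphM rmorph_nat.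
pose r := 1 - \sum_i t 0 i.
have r0 : 0 < r by rewrite subr_gt0.
have U0 : U = 0.
  (* Half of the slack [r] keeps every sample point strictly below the slanted face. *)
  apply: (@poly_vanish_harmonic _ _ (r / 2)%:C).
    by rewrite -(rmorph0 (real_complex R)) (inj_eq (@complexI R)) gt_eqF // divr_gt0.
  move=> k; rewrite -(rmorph_nat (real_complex R)) -fmorphV -rmorphM UE.
  set s := _ / _; have s0 : 0 <= s by rewrite divr_ge0 // divr_ge0 // ltW.
  have sr : s < r.
    rewrite /s ltr_pdivrMr ?ltr0n // (@lt_le_trans _ _ r) //; first by lra.
    by rewrite ler_peMr ?ler1n // ltW.
  apply: hP => [i|]; first by rewrite mxE addr_ge0 // mulr_ge0.
  under eq_bigr do rewrite mxE.
  rewrite big_split /= [X in _ + X](bigD1 j) //= eqxx mul1r [X in _ + (_ + X)]big1 => [|i ij];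
    last by rewrite (negbTE ij) mul0r.
  by rewrite /r in sr *; lra.
have -> : t = \row_i (t 0 i + (i == j)%:R * 0).
  by apply/rowP => i; rewrite mxE mulr0 addr0.
rewrite -UE.
have := @mmap_chain_rule _ _ _ (@polyC C) f (@deriv C) (@derivM C) (@derivC C) P.
rewrite -/U U0 raddf0 (bigD1 j) //= big1 ?addr0 => [|i ij].
  by rewrite /f eqxx scale1r derivD derivC derivX add0r mulr1 => <-; rewrite horner0.
by rewrite /f (negbTE ij) scale0r addr0 derivC mulr0.
Qed.

(** All iterated derivatives vanish at the origin, a point of the region, and they determine the
    coefficients of [P]. *)
Lemma evalR_vanish m (P : {mpoly C[m]}) :
  (forall t : 'rV[R]_m, (forall i, 0 <= t 0 i) -> \sum_i t 0 i < 1 -> evalR P t = 0) ->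
  P = 0.
Proof.
move=> hP; apply/mpolyP => al; rewrite mcoeff0.
have h0 : evalR (mderivm al P) 0 = 0.
  rewrite mderivm_foldr /=; move: (flatten _) => s.
  suff : forall t : 'rV[R]_m, (forall i, 0 <= t 0 i) -> \sum_i t 0 i < 1 ->
     evalR (foldr (@mderiv _ _) P s) t = 0.
    by apply => [i|]; rewrite ?mxE // big1 // => i _; rewrite mxE.
  by elim: s => //= i s IH; apply: evalR_deriv_vanish.
move: h0; rewrite /evalR.
have -> Q : Q.@[fun j : 'I_m => ((0 : 'rV[R]_m) 0 j)%:C] = Q@_0%MM.
  elim/mpolyind: Q => [|c be p _ _ IH]; first by rewrite !raddf0.
  rewrite mevalD mcoeffD IH mevalZ mcoeffZ mcoeffX -/(evalR _ _) evalR_mono; congr (_ * _ + _).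
  have [->|/eqP ne] := eqVneq be 0%MM.
    by rewrite big1 // => j _; rewrite mnm0E expr0.
  have [j bj] : exists j, be j != 0%N.
    apply/existsP; apply: contraT; rewrite negb_exists => /forallP h.
    by case: ne; apply/mnmP => j; rewrite mnm0E; apply/eqP; move: (h j); rewrite negbK.
  by rewrite (bigD1 j) //= mxE expr0n (negbTE bj) mul0r.
(* The constant term of the derivative of order [al] is [P@_al] times a product of factorials, which
   is nonzero. *)
rewrite mcoeff_mderivm addm0 => /eqP; rewrite -mulr_natr mulf_eq0.
rewrite pnatr_eq0 => /orP[/eqP //|].
rewrite -leqn0 leqNgt prodn_gt0 // => i.
by rewrite ffactnn fact_gt0.
Qed.

Lemma Re_norm_ge0 (z : C) : 0 <= complex.Re (z * conjc z).
Proof. by case: z => a b /=; rewrite mulrN opprK addr_ge0 // -expr2 sqr_ge0. Qed.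

Lemma Re_norm_eq0 (z : C) : complex.Re (z * conjc z) = 0 -> z = 0.
Proof.
case: z => a b /= /eqP; rewrite mulrN opprK -!expr2 paddr_eq0 ?sqr_ge0 //.
by rewrite !sqrf_eq0 => /andP[/eqP -> /eqP ->].
Qed.

Lemma simC_norm_ge0 m (P : {mpoly C[m]}) : 0 <= complex.Re (simC (evalR (P * conjP P))).
Proof.
apply: simint_ge0 => // t _ _.
by rewrite /evalR mevalM -!/(evalR _ t) evalR_conjP Re_norm_ge0.
Qed.

(** [|P|^2] is a nonnegative Dirichlet sum of zero integral, so it vanishes off the slanted face,
    and [P] with it. *)
Lemma simC_norm_eq0 m (P : {mpoly C[m]}) :
  complex.Re (simC (evalR (P * conjP P))) = 0 -> P = 0.
Proof.
move=> /= h; apply: evalR_vanish => t t0 t1.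
have E u : complex.Re (evalR P u * conjc (evalR P u)) =
    dirichlet_sum (msupp (P * conjP P)) (fun al => complex.Re (P * conjP P)@_al)
      (fun=> 0%N) (fun al j => al j) 1 u.
  rewrite -evalR_conjP {1 2}/evalR -mevalM -/(evalR _ _) evalRE Re_sum.
  by apply: eq_bigr => al _; rewrite Re_mulr.
apply: Re_norm_eq0; rewrite E; apply: simint_dirichlet_eq0 => //.
  by move=> u _ _; rewrite -E Re_norm_ge0.
rewrite -{}h; congr simint; apply/funext => u; rewrite -E -evalR_conjP.
by rewrite {3}/evalR mevalM.
Qed.

End ComplexSimplex.

(** * The divergence theorem *)

Section Reference.
Context {R : realType}.
Local Notation C := R[i].
Local Open Scope complex_scope.

(** Parametrises the faces of the reference simplex: [x = 0] gives the coordinate face [k], and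
    [x = 1 - sum t] the slanted face. *)
Definition insert_coord n (k : 'I_n.+1) (x : R) (t : 'rV[R]_n) : 'rV[R]_n.+1 :=
  \row_j (if unlift k j is Some j' then t 0 j' else x).

Lemma insert_coord_eq n (k : 'I_n.+1) x (t : 'rV[R]_n) : insert_coord k x t 0 k = x.
Proof. by rewrite mxE unlift_none. Qed.

Lemma insert_coord_lift n (k : 'I_n.+1) x (t : 'rV[R]_n) j :
  insert_coord k x t 0 (lift k j) = t 0 j.
Proof. by rewrite mxE liftK. Qed.

Lemma prod_insert_coord n (k : 'I_n.+1) x (t : 'rV[R]_n) (al : 'I_n.+1 -> nat) :
  \prod_j insert_coord k x t 0 j ^+ al j = x ^+ al k * \prod_j t 0 j ^+ al (lift k j).
Proof.
rewrite (bigD1_ord k) //= insert_coord_eq; congr (_ * _).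
by apply: eq_bigr => j _; rewrite insert_coord_lift.
Qed.

(** The right-hand side is free of [k]: a monomial has the same integral over the slanted face
    whichever coordinate is eliminated, so one parametrisation, by [ord0], serves for all
    directions. *)
Lemma dirichlet_lift n (k : 'I_n.+1) (al : 'I_n.+1 -> nat) :
  dirichlet (al k) (fun j => al (lift k j)) =
  (\prod_j (al j)`!)%:R / (\sum_j al j + n)`!%:R :> R.
Proof. by rewrite /dirichlet (bigD1_ord k) //= [in RHS](bigD1_ord k). Qed.

(** The fundamental theorem of calculus on one monomial. If [al k = 0], the two face terms cancel by
    symmetry; otherwise the coordinate face contributes nothing and [al_k (al_k - 1)! = al_k!] gives
    the slanted term. *)
Lemma dirichlet_deriv n (k : 'I_n.+1) (al : 'X_{1..n.+1}) :
  (al k)%:R * dirichlet 0 (al - U_(k))%MM =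
  dirichlet (al ord0) (fun j => al (lift ord0 j))
  - (al k == 0%N)%:R * dirichlet 0 (fun j => al (lift k j)) :> R.
Proof.
rewrite dirichlet_lift; have [ak|ak] := eqVneq (al k) 0%N.
  have := dirichlet_lift k al; rewrite ak => ->.
  by rewrite mul0r mul1r subrr.
rewrite mul0r subr0 /dirichlet.
have aU j : (al - U_(k))%MM (lift k j) = al (lift k j).
  by rewrite mnmBE mnm1E (negbTE (neq_lift _ _)) subn0.
have aK : al k = ((al - U_(k))%MM k).+1.
  by rewrite mnmBE mnm1E eqxx subn1 prednK // lt0n.
have hs : (\sum_j al j = (\sum_j (al - U_(k))%MM j).+1)%N.
  rewrite (bigD1_ord k) //= [in RHS](bigD1_ord k) //= {1}aK addSn.
  by congr (_ + _).+1; apply: eq_bigr => j _; rewrite aU.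
have hp : (\prod_j (al j)`! = al k * \prod_j ((al - U_(k))%MM j)`!)%N.
  rewrite (bigD1_ord k) //= [in RHS](bigD1_ord k) //= {1}aK factS -aK mulnA.
  by congr (_ * _)%N; apply: eq_bigr => j _; rewrite aU.
by rewrite fact0 mul1n add0n hs hp natrM addnS addSn mulrA.
Qed.

Lemma simC_mderiv n (k : 'I_n.+1) (P : {mpoly C[n.+1]}) :
  simC (evalR (mderiv k P)) =
    simC (fun t => evalR P (insert_coord ord0 (1 - \sum_j t 0 j) t))
    - simC (fun t => evalR P (insert_coord k 0 t)).
Proof.
transitivity (simC (fun t : 'rV[R]_n.+1 => \sum_(al <- msupp P) (P@_al * (al k)%:R)
    * ((1 - \sum_j t 0 j) ^+ 0 * \prod_j t 0 j ^+ (al - U_(k))%MM j)%:C)).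
  apply: eq_simC => t _ _; rewrite /mderiv /evalR raddf_sum; apply: eq_bigr => al _.
  by rewrite /= mevalZ -/(evalR _ t) evalR_mono expr0 mul1r [P@_al * _]mulrC.
have -> : simC (fun t => evalR P (insert_coord ord0 (1 - \sum_j t 0 j) t)) =
    simC (fun t : 'rV[R]_n => \sum_(al <- msupp P) P@_al
    * ((1 - \sum_j t 0 j) ^+ al ord0 * \prod_j t 0 j ^+ al (lift ord0 j))%:C).
  apply: eq_simC => t _ _; rewrite evalRE; apply: eq_bigr => al _.
  by rewrite expr0 mul1r prod_insert_coord.
have -> : simC (fun t => evalR P (insert_coord k 0 t)) =
    simC (fun t : 'rV[R]_n => \sum_(al <- msupp P) (P@_al * (al k == 0%N)%:R)
    * ((1 - \sum_j t 0 j) ^+ 0 * \prod_j t 0 j ^+ al (lift k j))%:C).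
  apply: eq_simC => t _ _; rewrite evalRE; apply: eq_bigr => al _.
  by rewrite !expr0 !mul1r prod_insert_coord expr0n rmorphM rmorph_nat mulrA.
rewrite !simC_dirichlet -sumrB; apply: eq_bigr => al _.
rewrite -!mulrA -mulrBr; congr (_ * _).
by rewrite -!(rmorph_nat (real_complex R)) -!rmorphM -rmorphB dirichlet_deriv.
Qed.

Lemma simC_sum m (I : Type) (r : seq I) (F : I -> {mpoly C[m]}) :
  simC (evalR (\sum_(k <- r) F k)) = \sum_(k <- r) simC (evalR (F k)).
Proof.
elim: r => [|k r IH].
  rewrite !big_nil; have := simC_linear (-1) (0 : {mpoly C[m]}) 0.
  by rewrite scaler0 addr0 mulN1r addNr.
by rewrite !big_cons -IH -[F k]scale1r simC_linear mul1r scale1r.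
Qed.

Lemma simCZ m (c : C) (P : {mpoly C[m]}) : simC (evalR (c *: P)) = c * simC (evalR P).
Proof.
have s0 : simC (evalR (0 : {mpoly C[m]})) = 0.
  by have := @simC_sum m unit [::] (fun=> 0); rewrite !big_nil.
by rewrite -[c *: P]addr0 simC_linear s0 addr0.
Qed.

End Reference.

(** * Gram determinants and unit normals *)

Section Normals.
Context {R : realType} (n : nat).
Local Notation d := n.+1.

Lemma dotE (x y : 'rV[R]_d) : dot x y = (x *m y^T) 0 0.
Proof. by rewrite mxE; apply: eq_bigr => j _; rewrite mxE. Qed.

(* Replacing row [k] of [B] by the normal [nu] gives a matrix [M] with
   [det M ^ 2 = det (E E^T)] and [det M = det B / tau]. *)
Lemma sqrt_gram_row' (B : 'M[R]_d) (k : 'I_d) (nu : 'rV[R]_d) (tau : R) :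
  \det B != 0 -> dot nu nu = 1 -> tau < 0 -> B *m nu^T = tau *: delta_mx k 0 ->
  Num.sqrt (\det (row' k B *m (row' k B)^T)) * tau = - `|\det B|.
Proof.
move=> B0 nu1 tau0 Bnu.
have tau_neq0 : tau != 0 by rewrite lt_eqF.
have Bu : B \in unitmx by rewrite unitmxE unitfE.
pose M := \matrix_(i, j) (if i == k then nu 0 j else B i j).
have Mk : row k M = nu by apply/rowP => j; rewrite !mxE eqxx.
have rowM : row' k M = row' k B.
  by apply/matrixP => i j; rewrite !mxE eq_sym (negbTE (neq_lift _ _)).
have nuB : nu *m B^T = tau *: delta_mx 0 k.
  by rewrite -[nu]trmxK -trmx_mul Bnu linearZ /= trmx_delta.
have nuM : nu *m M^T = delta_mx 0 k.
  apply/rowP => j; have [->|jk] := eqVneq j k.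
    rewrite !mxE !eqxx -[RHS]nu1.
    by apply: eq_bigr => l _; rewrite !mxE eqxx.
  transitivity ((nu *m B^T) 0 j); last by rewrite nuB !mxE eqxx (negbTE jk) mulr0.
  by rewrite !mxE; apply: eq_bigr => l _; rewrite !mxE (negbTE jk).
(* [nu] is a unit vector orthogonal to the other rows, so row [k] of [M M^T] is a basis vector and
   expansion along it leaves the Gram determinant. *)
have detMM : \det M ^+ 2 = \det (row' k B *m (row' k B)^T).
  have -> : \det M ^+ 2 = \det (M *m M^T) by rewrite det_mulmx det_tr expr2.
  rewrite (expand_det_row _ k) (bigD1 k) //= big1 ?addr0 => [|j jk].
    have -> : (M *m M^T) k k = 1.
      have := congr1 (fun X : 'rV_d => X 0 k) nuM; rewrite -{1}Mk -row_mul mxE => ->.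
      by rewrite mxE !eqxx.
    rewrite mul1r /cofactor addnn -mul2n exprM sqrrN expr1n expr1n mul1r.
    congr (\det _); apply/matrixP => i j; rewrite !mxE; apply: eq_bigr => l _.
    by rewrite !mxE ![_ == k]eq_sym !(negbTE (neq_lift _ _)).
  have -> : (M *m M^T) k j = 0; last by rewrite mul0r.
  have := congr1 (fun X : 'rV_d => X 0 j) nuM; rewrite -{1}Mk -row_mul mxE => ->.
  by rewrite mxE eqxx (negbTE jk).
(* [nu] is [tau] times column [k] of [B^-1], so [M B^-1] is the identity outside row [k] and has
   [1 / tau] at [(k, k)]. *)
have detM : \det M * tau = \det B.
  have nuE : nu^T = tau *: (invmx B *m delta_mx k 0).
    by rewrite scalemxAr -Bnu mulKmx.
  have detMG : \det (M *m invmx B) = tau^-1.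
    have MG i j : i != k -> (M *m invmx B) i j = (i == j)%:R.
      move=> ik; have <- : (B *m invmx B) i j = (i == j)%:R by rewrite mulmxV // mxE.
      by rewrite !mxE; apply: eq_bigr => l _; rewrite mxE (negbTE ik).
    rewrite (expand_det_col _ k) (bigD1 k) //= big1 ?addr0 => [|i ik].
      have -> : (M *m invmx B) k k = tau^-1.
        apply: (mulfI tau_neq0); rewrite mulfV // -[RHS]nu1 dotE nuE -scalemxAr [RHS]mxE.
        by congr (_ * _); rewrite mulmxA -colE -Mk -row_mul [RHS]mxE [RHS]mxE.
      rewrite /cofactor addnn -mul2n exprM sqrrN expr1n expr1n mul1r.
      rewrite (_ : row' k _ = 1%:M) ?det1 ?mulr1 //.
      apply/matrixP => i j; rewrite mxE mxE MG ?mxE ?(inj_eq lift_inj) //.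
      by rewrite eq_sym neq_lift.
    by rewrite MG // (negbTE ik) mul0r.
  apply: (mulIf (invr_neq0 B0)); rewrite divff // mulrAC.
  by rewrite -det_inv -det_mulmx detMG mulVf.
rewrite -detMM sqrtr_sqr -detM normrM (ltr0_norm tau0).
by rewrite mulrN opprK.
Qed.

End Normals.

(** * From the reference simplex to a general one *)

Section Simplices.
Context {R : realType} {n : nat}.
Local Notation C := R[i].
Local Notation d := n.+1.
Local Notation point := 'rV[R]_d.
Local Notation CPoly := {mpoly C[d]}.
Local Open Scope complex_scope.

Fact pull_key : unit. Proof. by []. Qed.

(* Locked, as is [conjP]: otherwise unification unfolds polynomial arithmetic. *)
Definition pull m (b : 'I_m.+1 -> point) (P : CPoly) : {mpoly C[m]} :=
  locked_with pull_key
  (P \mPo [tuple ((b ord0 0 j)%:C)%:MP + \sum_i (edges b i j)%:C *: 'X_i | j < d]).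

Lemma pullE m (b : 'I_m.+1 -> point) (P : CPoly) : pull b P =
  P \mPo [tuple ((b ord0 0 j)%:C)%:MP + \sum_i (edges b i j)%:C *: 'X_i | j < d].
Proof. exact: locked_withE. Qed.

Lemma evalR_pull m (b : 'I_m.+1 -> point) (P : CPoly) t :
  evalR (pull b P) t = ev P (b ord0 + t *m edges b).
Proof.
rewrite /evalR pullE comp_mpoly_meval /ev; apply: meval_eq => j.
rewrite tnth_mktuple mevalD mevalC !mxE rmorphD /=; congr (_ + _).
rewrite raddf_sum rmorph_sum /=; apply: eq_bigr => i _.
by rewrite mevalZ mevalXU rmorphM mulrC.
Qed.

Lemma pull_linear m (b : 'I_m.+1 -> point) (c : C) (P Q : CPoly) :
  pull b (c *: P + Q) = c *: pull b P + pull b Q.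
Proof. by rewrite !pullE comp_mpolyD comp_mpolyZ. Qed.

Lemma pull0 m (b : 'I_m.+1 -> point) : pull b 0 = 0.
Proof. by rewrite pullE comp_mpoly0. Qed.

Lemma pullZ m (b : 'I_m.+1 -> point) (c : C) (P : CPoly) : pull b (c *: P) = c *: pull b P.
Proof. by rewrite -[c *: P]addr0 pull_linear pull0 addr0. Qed.

Lemma pull_sum m (b : 'I_m.+1 -> point) (I : Type) (r : seq I) (F : I -> CPoly) :
  pull b (\sum_(i <- r) F i) = \sum_(i <- r) pull b (F i).
Proof.
elim: r => [|i r IH]; first by rewrite !big_nil pull0.
by rewrite !big_cons -IH -[F i]scale1r pull_linear !scale1r.
Qed.

Lemma mderiv_pull m (b : 'I_m.+1 -> point) (k : 'I_m) (P : CPoly) :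
  mderiv k (pull b P) = \sum_j (edges b k j)%:C *: pull b (mderiv j P).
Proof.
rewrite pullE; under eq_bigr do rewrite pullE; rewrite /comp_mpoly.
rewrite (@mmap_chain_rule _ _ _ (@mpolyC m C) _ (mderiv k) (mderivM k) (mderivC k)).
apply: eq_bigr => j _; rewrite -[RHS]mul_mpolyC mulrC; congr (_ * _).
rewrite tnth_mktuple /= mderivD mderivC add0r raddf_sum (bigD1 k) //= big1 ?addr0.
  rewrite mderivZ mderivX mnm1E eqxx scale1r (_ : (U_(k) - U_(k))%MM = 0%MM).
    by rewrite mpolyX0 -mul_mpolyC mulr1.
  by apply/mnmP => i; rewrite mnmBE subnn mnm0E.
by move=> i ik; rewrite mderivZ mderivX mnm1E (negbTE ik) scale0r scaler0.
Qed.

Lemma cintE m (b : 'I_m.+1 -> point) (f : point -> C) :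
  cint b f = (Num.sqrt (\det (edges b *m (edges b)^T)))%:C *
             simC (fun t => f (b ord0 + t *m edges b)).
Proof. by rewrite /cint /affint /simC; simpc. Qed.

Lemma cint_ev m (b : 'I_m.+1 -> point) (P : CPoly) :
  cint b (ev P) = (Num.sqrt (\det (edges b *m (edges b)^T)))%:C * simC (evalR (pull b P)).
Proof.
rewrite cintE; congr (_ * _); apply: eq_simC => t _ _.
by rewrite evalR_pull.
Qed.

Lemma cint_linear m (b : 'I_m.+1 -> point) (c : C) (P Q : CPoly) :
  cint b (ev (c *: P + Q)) = c * cint b (ev P) + cint b (ev Q).
Proof. by rewrite !cint_ev pull_linear simC_linear mulrDr mulrCA. Qed.

Lemma ev_conjP (P : CPoly) x : ev (conjP P) x = conjc (ev P x).
Proof. exact: evalR_conjP. Qed.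

Lemma evM (P Q : CPoly) x : ev (P * Q) x = ev P x * ev Q x.
Proof. exact: mevalM. Qed.

Lemma cint_conjP m (b : 'I_m.+1 -> point) (P : CPoly) :
  cint b (ev (conjP P)) = conjc (cint b (ev P)).
Proof.
rewrite cintE cint_ev conjcM conjc_real; congr (_ * _); rewrite -simC_conjP.
by apply: eq_simC => t _ _; rewrite ev_conjP evalR_conjP evalR_pull.
Qed.

Lemma eq_cint m (b : 'I_m.+1 -> point) (f g : point -> C) :
  (forall x, hull b x -> f x = g x) -> cint b f = cint b g.
Proof.
move=> fg; rewrite !cintE; congr (_ * _); apply: eq_simC => t t0 t1; apply: fg.
(* Barycentric coordinates of the parametrised point: the base vertex receives the slack. *)
exists (fun j => if unlift ord0 j is Some j' then t 0 j' else 1 - \sum_j t 0 j); split.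
  by move=> j; case: unlift => [j'|] //; rewrite subr_ge0.
split.
  rewrite big_ord_recl unlift_none [X in _ + X](eq_bigr (fun j => t 0 j)) ?subrK //.
  by move=> j _; rewrite liftK.
rewrite big_ord_recl unlift_none.
rewrite [X in _ = _ + X](eq_bigr (fun j => t 0 j *: b (lift ord0 j))) => [|j _]; last first.
  by rewrite liftK.
apply/rowP => j; rewrite !mxE summxE mulrBl mul1r -addrA; congr (_ + _).
rewrite addrC mulr_suml -sumrB; apply: eq_bigr => i _.
by rewrite !mxE mulrBr.
Qed.

Lemma sqrt_gram_edges (a : 'I_d.+1 -> point) :
  Num.sqrt (\det (edges a *m (edges a)^T)) = `|\det (edges a)|.
Proof. by rewrite det_mulmx det_tr -expr2 sqrtr_sqr. Qed.

Lemma evalRM m (P Q : {mpoly C[m]}) t : evalR (P * Q) t = evalR P t * evalR Q t.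
Proof. exact: mevalM. Qed.

Lemma cint_norm (a : 'I_d.+1 -> point) (P : CPoly) :
  cint a (ev (P * conjP P)) =
  `|\det (edges a)|%:C * simC (evalR (pull a P * conjP (pull a P))).
Proof.
rewrite cintE sqrt_gram_edges; apply: (congr1 (GRing.mul _)); apply: eq_simC => t _ _.
by rewrite evM ev_conjP evalRM evalR_conjP evalR_pull.
Qed.

Lemma cint_norm_ge0 (a : 'I_d.+1 -> point) (P : CPoly) :
  0 <= complex.Re (cint a (ev (P * conjP P))).
Proof. by rewrite cint_norm mulrC Re_mulr mulr_ge0 // simC_norm_ge0. Qed.

Lemma cint_norm_eq0 (a : 'I_d.+1 -> point) (P : CPoly) : Defs.nondegenerate a ->
  complex.Re (cint a (ev (P * conjP P))) = 0 -> P = 0.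
Proof.
move=> a0; rewrite cint_norm mulrC Re_mulr => /eqP.
rewrite mulf_eq0 normr_eq0 (negbTE a0) orbF => /eqP /simC_norm_eq0 pP0.
apply: evalR_vanish => x _ _.
(* Nondegeneracy makes the parametrisation onto, so any [x] has a preimage, where the zero pullback
   is evaluated. *)
have := evalR_pull a P ((x - a ord0) *m invmx (edges a)).
rewrite pP0 /evalR meval0 mulmxKV ?unitmxE ?unitfE // => h.
by rewrite -[LHS]/(ev P x) h addrC subrK.
Qed.

Lemma edges_facev_lift (a : 'I_d.+1 -> point) (k : 'I_d) :
  edges (facev a (lift ord0 k)) = row' k (edges a).
Proof.
apply/matrixP => i j; rewrite !mxE /facev; congr (a _ 0 j - a _ 0 j); apply: val_inj => //=.
by rewrite /bump /= !add1n ltnS addnS.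
Qed.

(** The face opposite vertex 0 does not contain the base point of [edges a]. Rebasing at vertex 1,
    with the edge to vertex 0 as first row, makes this face a row deletion too. *)
Definition edges_from1 (a : 'I_d.+1 -> point) : 'M[R]_d :=
  \matrix_(i, j) if unlift ord0 i is Some i'
    then a (lift ord0 (lift ord0 i')) 0 j - a (lift ord0 ord0) 0 j
    else a ord0 0 j - a (lift ord0 ord0) 0 j.

Lemma edges_facev_ord0 (a : 'I_d.+1 -> point) :
  edges (facev a ord0) = row' ord0 (edges_from1 a).
Proof. by apply/matrixP => i j; rewrite !mxE liftK. Qed.

(** Change of base vertex: it negates row 0 and subtracts row 0 from the others. It is lower
    triangular with determinant [-1]. *)
Definition shear : 'M[R]_d :=
  \matrix_(i, j) ((i != ord0) && (i == j))%:R - \matrix_(i, j) (j == ord0)%:R.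

Lemma edges_from1E (a : 'I_d.+1 -> point) : edges_from1 a = shear *m edges a.
Proof.
apply/matrixP => i j; rewrite mulmxBl !mxE.
rewrite [X in _ = _ - X](bigD1 ord0) //= [X in _ = _ - (_ + X)]big1 ?addr0 => [|l l0]; last first.
  by rewrite !mxE (negbTE l0) mul0r.
rewrite (bigD1 i) //= big1 ?addr0 => [|l li]; last first.
  by rewrite !mxE [i == l]eq_sym (negbTE li) andbF mul0r.
rewrite !mxE !eqxx andbT mul1r.
case: unliftP => [i' ->|->]; last by rewrite eqxx mul0r sub0r opprB.
by rewrite eq_sym neq_lift mul1r; ring.
Qed.

Lemma normr_det_edges_from1 (a : 'I_d.+1 -> point) :
  `|\det (edges_from1 a)| = `|\det (edges a)|.
Proof.
rewrite edges_from1E det_mulmx normrM det_trig; last first.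
  apply/is_trig_mxP => i j ij.
  have ne : (i == j) = false by rewrite -val_eqE /= ltn_eqF.
  have j0 : (j == ord0) = false by rewrite -val_eqE /= gtn_eqF // (leq_ltn_trans _ ij).
  by rewrite !mxE ne j0 andbF subr0.
rewrite big_ord_recl big1 => [|i _]; last first.
  by rewrite !mxE eqxx eq_sym neq_lift subr0.
by rewrite !mxE eqxx sub0r mulr1 normrN1 mul1r.
Qed.

(** The normal is orthogonal to every edge from vertex 0 except edge [k], on which its value [tau]
    is negative. Once weighted by the Gram factor of the face, it becomes column [k] of
    [- |det| E^-1], where [E = edges a]. *)
Lemma face_normal_lift (a : 'I_d.+1 -> point) (k : 'I_d) (nu : point) :
  Defs.nondegenerate a -> unit_outward_normal a (lift ord0 k) nu ->
  edges a *m (Num.sqrt (\det (edges (facev a (lift ord0 k)) *m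
     (edges (facev a (lift ord0 k)))^T)) *: nu)^T
  = - `|\det (edges a)| *: delta_mx k 0.
Proof.
move=> a0 [nu1 [nuT nuO]].
have l0 : lift (lift ord0 k) ord0 = ord0 :> 'I_d.+1 by apply: val_inj.
set tau := dot nu (a (lift ord0 k) - a (lift (lift ord0 k) ord0)).
have Bnu : edges a *m nu^T = tau *: delta_mx k 0.
  apply/colP => i; rewrite !mxE andbT.
  have -> : \sum_j edges a i j * nu^T j 0 = dot nu (a (lift ord0 i) - a ord0).
    by apply: eq_bigr => j _; rewrite !mxE mulrC.
  case: (unliftP k i) => [i' ->|->]; last by rewrite eqxx mulr1 /tau l0.
  rewrite eq_sym (negbTE (neq_lift _ _)) mulr0 -[RHS](nuT (lift ord0 i' : 'I_d) ord0) l0.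
  congr (dot nu (a _ - _)); apply: val_inj.
  by rewrite /= /bump /= !add1n ltnS addnS.
rewrite edges_facev_lift linearZ /= -scalemxAr Bnu scalerA.
by rewrite (sqrt_gram_row' a0 nu1 nuO Bnu).
Qed.

(** All edges from vertex 0 end on this face, so they have the same product with [nu]. The weighted
    normal is thus the opposite of the sum of those of the other faces. *)
Lemma face_normal_ord0 (a : 'I_d.+1 -> point) (nu : point) :
  Defs.nondegenerate a -> unit_outward_normal a ord0 nu ->
  edges a *m (Num.sqrt (\det (edges (facev a ord0) *m (edges (facev a ord0))^T)) *: nu)^T
  = const_mx `|\det (edges a)|.
Proof.
move=> a0 [nu1 [nuT nuO]].
set tau := dot nu (a ord0 - a (lift ord0 ord0)) in nuO.
have rowE i : (edges a *m nu^T) i 0 = - tau.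
  have -> : (edges a *m nu^T) i 0 = dot nu (a (lift ord0 i) - a ord0).
    by rewrite mxE; apply: eq_bigr => j _; rewrite !mxE mulrC.
  have h := nuT i ord0; apply/eqP; rewrite -addr_eq0 -h /tau /dot -big_split.
  by apply/eqP/eq_bigr => j _; rewrite !mxE /=; ring.
have Bnu : edges_from1 a *m nu^T = tau *: delta_mx ord0 0.
  rewrite edges_from1E -mulmxA.
  have -> : edges a *m nu^T = const_mx (- tau).
    by apply/colP => i; rewrite rowE mxE.
  rewrite mulmxBl; apply/colP => i; rewrite !mxE.
  rewrite [X in _ - X = _](bigD1 ord0) //= [X in _ - (_ + X) = _]big1 ?addr0 => [|l l0]; last first.
    by rewrite !mxE (negbTE l0) mul0r.
  rewrite (bigD1 i) //= big1 ?addr0 => [|l li]; last first.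
    by rewrite !mxE [i == l]eq_sym (negbTE li) andbF mul0r.
  rewrite !mxE !eqxx !andbT mul1r.
  by case: eqVneq => _ /=; ring.
have b0 : \det (edges_from1 a) != 0.
  by rewrite -normr_eq0 normr_det_edges_from1 normr_eq0.
have key := sqrt_gram_row' b0 nu1 nuO Bnu.
rewrite edges_facev_ord0 linearZ /= -scalemxAr; apply/colP => i.
by rewrite mxE rowE mulrN key normr_det_edges_from1 opprK mxE.
Qed.

Lemma facept_lift (a : 'I_d.+1 -> point) (k : 'I_d) (t : 'rV[R]_n) :
  facev a (lift ord0 k) ord0 + t *m edges (facev a (lift ord0 k)) =
  a ord0 + insert_coord k 0 t *m edges a.
Proof.
rewrite edges_facev_lift; congr (_ + _).
  by rewrite /facev; congr a; exact: val_inj.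
apply/rowP => j; rewrite !mxE (bigD1_ord k) //= insert_coord_eq mul0r add0r.
by apply: eq_bigr => i _; rewrite insert_coord_lift mxE.
Qed.

Lemma facept_ord0 (a : 'I_d.+1 -> point) (t : 'rV[R]_n) :
  facev a ord0 ord0 + t *m edges (facev a ord0) =
  a ord0 + insert_coord ord0 (1 - \sum_j t 0 j) t *m edges a.
Proof.
apply/rowP => j; rewrite !mxE (bigD1_ord ord0) //= insert_coord_eq.
rewrite [edges a ord0 j]mxE.
rewrite [X in _ = _ + (_ + X)](_ : _ = \sum_i t 0 i * edges (facev a ord0) i j
    + (\sum_i t 0 i) * (a (lift ord0 ord0) 0 j - a ord0 0 j)).
  by rewrite /facev; ring.
rewrite mulr_suml -big_split; apply: eq_bigr => i _.
by rewrite insert_coord_lift !mxE /facev /=; ring.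
Qed.

Lemma scale_ndot (s : R) (nu : point) (v : 'I_d -> CPoly) :
  s%:C *: ndot nu v = \sum_j ((s *: nu) 0 j)%:C *: v j.
Proof.
rewrite /ndot scaler_sumr; apply: eq_bigr => j _.
by rewrite scalerA -rmorphM mxE.
Qed.

(** In reference coordinates the divergence is that of the transformed field [W], and [simC_mderiv]
    integrates each [k]-th derivative. Coordinate face [k] is the face opposite vertex [k + 1]; the
    slanted face is the one opposite vertex 0. *)
Theorem divergence_theorem (a : 'I_d.+1 -> point) (nu : 'I_d.+1 -> point)
    (v : 'I_d -> CPoly) : Defs.nondegenerate a ->
  (forall i, unit_outward_normal a i (nu i)) ->
  cint a (ev (divpoly v)) = \sum_i cint (facev a i) (ev (ndot (nu i) v)).
Proof.
move=> a0 hnu; pose G := invmx (edges a); pose V := `|\det (edges a)|.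
have Bu : edges a \in unitmx by rewrite unitmxE unitfE.
(* Contravariant components of [v]: the Piola transform without its Jacobian factor. *)
pose W k : CPoly := \sum_j (G j k)%:C *: v j.
have divE : pull a (divpoly v) = \sum_k mderiv k (pull a (W k)).
  have GB j l : \sum_k G j k * edges a k l = (j == l)%:R.
    by have := congr1 (fun X : 'M[R]_d => X j l) (mulVmx Bu); rewrite !mxE.
  transitivity (\sum_j \sum_l \sum_k (G j k * edges a k l)%:C *: pull a (mderiv l (v j))).
    rewrite pull_sum; apply: eq_bigr => j _.
    transitivity (\sum_l (j == l)%:R *: pull a (mderiv l (v j))).
      rewrite (bigD1 j isT) eqxx scale1r big1 => [|l lj]; first by rewrite /= addr0.
      by rewrite eq_sym (negbTE lj) scale0r.
    by apply: eq_bigr => l _; rewrite -scaler_suml -rmorph_sum GB rmorph_nat.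
  transitivity (\sum_k \sum_j \sum_l (G j k * edges a k l)%:C *: pull a (mderiv l (v j))).
    by rewrite [RHS]exchange_big; apply: eq_bigr => j _; exact: exchange_big.
  apply: eq_bigr => k _; rewrite pull_sum [RHS]raddf_sum; apply: eq_bigr => j _.
  rewrite pullZ [RHS]mderivZ mderiv_pull scaler_sumr; apply: eq_bigr => l _.
  by rewrite scalerA -rmorphM.
rewrite cint_ev sqrt_gram_edges divE simC_sum mulr_sumr [RHS]big_ord_recl.
pose F0 k := simC (fun t : 'rV[R]_n =>
  evalR (pull a (W k)) (insert_coord ord0 (1 - \sum_j t 0 j) t)).
pose Fk k := simC (fun t : 'rV[R]_n => evalR (pull a (W k)) (insert_coord k 0 t)).
(* The slanted terms of all directions together form this one face, whose weighted normal has all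
   reference components equal to [V]. *)
have -> : cint (facev a ord0) (ev (ndot (nu ord0) v)) = \sum_k V%:C * F0 k.
  rewrite cint_ev -simCZ.
  set s := Num.sqrt _; set b := facev a ord0.
  have -> : s%:C *: pull b (ndot (nu ord0) v) = \sum_k V%:C *: pull b (W k).
    rewrite -pullZ scale_ndot -scaler_sumr -pull_sum -pullZ.
    apply: (congr1 (pull b)); rewrite exchange_big scaler_sumr; apply: eq_bigr => j _.
    rewrite -scaler_suml scalerA -rmorph_sum -rmorphM; congr (_%:C *: _).
    have h := face_normal_ord0 a0 (hnu ord0); rewrite -/s -/b in h.
    have <- : (invmx (edges a) *m (const_mx V : 'cV[R]_d)) j 0 = (s *: nu ord0) 0 j.
      by rewrite /V -h mulKmx // mxE.
    rewrite mxE mulr_sumr; apply: eq_bigr => k _; by rewrite [const_mx _ _ _]mxE mulrC.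
  rewrite simC_sum; apply: eq_bigr => k _; rewrite simCZ; congr (_ * _).
  by apply: eq_simC => t _ _; rewrite !evalR_pull facept_ord0.
rewrite -big_split; apply: eq_bigr => k _; rewrite simC_mderiv mulrBr; congr (_ + _).
rewrite cint_ev -simCZ.
set s := Num.sqrt _; set b := facev a _.
have -> : s%:C *: pull b (ndot (nu (lift ord0 k)) v) = (- V%:C) *: pull b (W k).
  rewrite -!pullZ scale_ndot scaler_sumr; apply: (congr1 (pull b)).
  apply: eq_bigr => j _; rewrite scalerA -rmorphN -rmorphM; congr (_%:C *: _).
  have h := face_normal_lift a0 (hnu (lift ord0 k)); rewrite -/s -/b in h.
  have <- : (invmx (edges a) *m (- V *: delta_mx k 0 : 'cV[R]_d)) j 0 = (s *: nu (lift ord0 k)) 0 j.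
    by rewrite /V -h mulKmx // mxE.
  by rewrite -scalemxAr -colE !mxE.
rewrite simCZ mulNr; congr (- (_ * _)); apply: eq_simC => t _ _.
by rewrite !evalR_pull facept_lift.
Qed.

End Simplices.

(** * Energy identity and strict contraction *)

Section InnerProducts.
Context {R : realType} {n : nat}.
Local Notation C := R[i].
Local Notation d := n.+1.
Local Notation point := 'rV[R]_d.
Local Notation CPoly := {mpoly C[d]}.

Lemma conjPE (P : CPoly) : conjP P = map_mpoly (@conjc R) P.
Proof. exact: locked_withE. Qed.

Lemma mcoeff_conjP (P : CPoly) al : (conjP P)@_al = conjc (P@_al).
Proof. by rewrite conjPE mcoeff_map_mpoly. Qed.

Lemma conjPM (P Q : CPoly) : conjP (P * Q) = conjP P * conjP Q.
Proof. by rewrite !conjPE; exact: rmorphM. Qed.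

Lemma conjPK (P : CPoly) : conjP (conjP P) = P.
Proof. by apply/mpolyP => al; rewrite !mcoeff_conjP conjcK. Qed.

Lemma mderiv_conjP (j : 'I_d) (P : CPoly) : mderiv j (conjP P) = conjP (mderiv j P).
Proof.
apply/mpolyP => al; rewrite mcoeff_conjP !mcoeff_mderiv mcoeff_conjP.
by rewrite -[in RHS]mulr_natr conjcM conjc_nat mulr_natr.
Qed.

(** Conjugating coefficients keeps the integrand a polynomial, so linearity of [cint] on polynomials
    applies. *)
Definition ip m (b : 'I_m.+1 -> point) (f g : CPoly) : C := cint b (ev (f * conjP g)).

Lemma ipE m (b : 'I_m.+1 -> point) (f g : CPoly) :
  cint b (fun x => ev f x * conjc (ev g x)) = ip b f g.
Proof. by apply: eq_cint => x _; rewrite evM ev_conjP. Qed.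

Lemma ip_linear m (b : 'I_m.+1 -> point) (c : C) (f f' g : CPoly) :
  ip b (c *: f + f') g = c * ip b f g + ip b f' g.
Proof. by rewrite /ip mulrDl -scalerAl cint_linear. Qed.

Lemma ip_conj m (b : 'I_m.+1 -> point) (f g : CPoly) : ip b g f = conjc (ip b f g).
Proof. by rewrite /ip -cint_conjP conjPM conjPK mulrC. Qed.

Lemma eq_ip m (b : 'I_m.+1 -> point) (f f' g : CPoly) :
  eqon (hull b) f f' -> ip b f g = ip b f' g.
Proof. by move=> h; apply: eq_cint => x hx; rewrite !evM h. Qed.

Lemma ipD m (b : 'I_m.+1 -> point) (f f' g : CPoly) :
  ip b (f + f') g = ip b f g + ip b f' g.
Proof. by rewrite -[f in LHS]scale1r ip_linear mul1r. Qed.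

Lemma ip0 m (b : 'I_m.+1 -> point) (g : CPoly) : ip b 0 g = 0.
Proof. by apply: (addrI (ip b 0 g)); rewrite -ipD !addr0. Qed.

Lemma ipZ m (b : 'I_m.+1 -> point) (c : C) (f g : CPoly) : ip b (c *: f) g = c * ip b f g.
Proof. by rewrite -[c *: f]addr0 ip_linear ip0 addr0. Qed.

Lemma ipB m (b : 'I_m.+1 -> point) (f f' g : CPoly) :
  ip b (f - f') g = ip b f g - ip b f' g.
Proof. by rewrite -scaleN1r ipD ipZ mulN1r. Qed.

Lemma cint_sum m (b : 'I_m.+1 -> point) (I : Type) (r : seq I) (F : I -> CPoly) :
  cint b (ev (\sum_(i <- r) F i)) = \sum_(i <- r) cint b (ev (F i)).
Proof. by rewrite cint_ev pull_sum simC_sum mulr_sumr; apply: eq_bigr => i _; rewrite cint_ev. Qed.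

Lemma Im_ip_self m (b : 'I_m.+1 -> point) (f : CPoly) : complex.Im (ip b f f) = 0.
Proof.
have := ip_conj b f f; case: (ip b f f) => x y /= [] h.
by lra.
Qed.

Section Element.
Context (a : 'I_d.+1 -> point) (nu : 'I_d.+1 -> point).
Context (a0 : Defs.nondegenerate a) (hnu : forall i, unit_outward_normal a i (nu i)).

(** Green's formula: the divergence theorem for the field [u_j * conjP q]. *)
Lemma ip_grad_div (u : 'I_d -> CPoly) (q : CPoly) :
  \sum_j ip a (u j) (mderiv j q) + ip a (divpoly u) q =
  \sum_i ip (facev a i) (ndot (nu i) u) q.
Proof.
transitivity (cint a (ev (divpoly (fun j => u j * conjP q)))).
  have -> : divpoly (fun j => u j * conjP q) =
      \sum_j (u j * conjP (mderiv j q)) + divpoly u * conjP q.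
    rewrite /divpoly mulr_suml -big_split; apply: eq_bigr => j _.
    by rewrite mderivM mderiv_conjP addrC.
  by rewrite -[X in ev (X + _)]scale1r cint_linear mul1r cint_sum.
rewrite (divergence_theorem _ a0 hnu); apply: eq_bigr => i _.
rewrite /ip; congr (cint _ (ev _)).
by rewrite /ndot mulr_suml; apply: eq_bigr => j _; rewrite scalerAl.
Qed.

Lemma ip_div_grad (v : 'I_d -> CPoly) (p : CPoly) :
  ip a p (divpoly v) + \sum_j ip a (mderiv j p) (v j) =
  \sum_i ip (facev a i) p (ndot (nu i) v).
Proof.
rewrite ip_conj (eq_bigr (fun j => conjc (ip a (v j) (mderiv j p)))) => [|j _].
  rewrite -conjc_sum -conjcD addrC ip_grad_div conjc_sum.
  by apply: eq_bigr => i _; rewrite -ip_conj.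
by rewrite -ip_conj.
Qed.

End Element.

End InnerProducts.

(** * Degree bounds *)

Section Degrees.
Context {R : realType} {n : nat}.
Local Notation C := R[i].
Local Notation d := n.+1.
Local Notation CPoly := {mpoly C[d]}.

Lemma msize_mderiv (j : 'I_d) (q : CPoly) : (msize (mderiv j q) <= (msize q).-1)%N.
Proof.
rewrite msizeE; apply/bigmax_leqP_seq => al; rewrite mcoeff_msupp mcoeff_mderiv => h _.
have : (al + U_(j))%MM \in msupp q.
  by rewrite mcoeff_msupp; apply: contraNneq h => ->; rewrite mul0rn.
by move/msize_mdeg_lt; rewrite mdegD mdeg1 addn1; case: (msize q).
Qed.

Lemma degleD p (q r : CPoly) : degle p q -> degle p r -> degle p (q + r).
Proof.
by move=> hq hr; apply: leq_trans (mmeasureD_le _ _ _) _; rewrite geq_max hq hr.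
Qed.

Lemma degleZ p (c : C) (q : CPoly) : degle p q -> degle p (c *: q).
Proof. by move=> hq; apply: leq_trans (msizeZ_le _ _) hq. Qed.

Lemma degleB p (q r : CPoly) : degle p q -> degle p r -> degle p (q - r).
Proof. by move=> hq hr; rewrite -scaleN1r; apply: degleD => //; apply: degleZ. Qed.

Lemma degle0 p : degle p (0 : CPoly).
Proof. by rewrite /degle mmeasure0. Qed.

Lemma degle_sum p (I : Type) (r : seq I) (F : I -> CPoly) :
  (forall i, degle p (F i)) -> degle p (\sum_(i <- r) F i).
Proof.
move=> h; elim: r => [|i r IH]; first by rewrite big_nil; exact: degle0.
by rewrite big_cons; apply: degleD.
Qed.

Lemma degle_mderiv p j (q : CPoly) : degle p q -> degle p (mderiv j q).
Proof. by move=> h; apply: leq_trans (msize_mderiv _ _) _; apply: leq_trans (leq_pred _) h. Qed.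

Lemma degle_divpoly p (v : 'I_d -> CPoly) : (forall j, degle p (v j)) -> degle p (divpoly v).
Proof. by move=> h; apply: degle_sum => j; apply: degle_mderiv. Qed.

Lemma degle_ndot p (nu : 'rV[R]_d) (v : 'I_d -> CPoly) :
  (forall j, degle p (v j)) -> degle p (ndot nu v).
Proof. by move=> h; apply: degle_sum => j; apply: degleZ. Qed.

(* The Laplacian lowers the degree, so it has no nonzero polynomial eigenvalue. *)
Lemma laplace_eigen_eq0 (q : CPoly) (c : C) : c != 0 ->
  \sum_j mderiv j (mderiv j q) = c *: q -> q = 0.
Proof.
move=> c0 h; apply/eqP; apply: contraT => q0.
have q_gt0 : (0 < msize q)%N by rewrite lt0n mmeasure_poly_eq0.
suff : (msize q < msize q)%N by rewrite ltnn.
rewrite -{1}(msizeZ q c0) -h -(prednK q_gt0) ltnS.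
apply: leq_trans (mmeasure_sum _ _ _ _) _; apply/bigmax_leqP_seq => j _ _.
by apply: leq_trans (msize_mderiv _ _) _; apply: leq_trans (leq_pred _) (msize_mderiv _ _).
Qed.

End Degrees.

(** * The real symmetric form attached to a face operator *)

Section FaceForm.
Context {R : realType} {n : nat}.
Local Notation C := R[i].
Local Notation d := n.+1.
Local Notation point := 'rV[R]_d.
Local Notation CPoly := {mpoly C[d]}.
Context (p : nat) (A Ainv : set point -> CPoly -> CPoly) (a : 'I_d.+1 -> point) (i : 'I_d.+1).
Context (hA : face_operator p A Ainv a i).
Local Notation F := (faceset a i).

(** Taking the real part makes the Hermitian form symmetric, so squares expand as for a real
    bilinear form. *)
Definition fform (phi psi : CPoly) : R :=
  complex.Re (ip (facev a i) (A F phi) psi).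

Lemma Re_add (x y : C) : complex.Re (x + y) = complex.Re x + complex.Re y.
Proof. by case: x; case: y. Qed.

Lemma Re_opp (x : C) : complex.Re (- x) = - complex.Re x.
Proof. by case: x. Qed.

Lemma Re_conjc (x : C) : complex.Re (conjc x) = complex.Re x.
Proof. by case: x. Qed.

Lemma ip_face_linear (c : C) (phi phi' psi : CPoly) : degle p phi -> degle p phi' ->
  ip (facev a i) (A F (c *: phi + phi')) psi =
  c * ip (facev a i) (A F phi) psi + ip (facev a i) (A F phi') psi.
Proof.
case: hA => _ [_ [lin _]] h h'; rewrite -ip_linear; apply: eq_ip.
exact: lin.
Qed.

Lemma ip_faceD (phi phi' psi : CPoly) : degle p phi -> degle p phi' ->
  ip (facev a i) (A F (phi + phi')) psi =
  ip (facev a i) (A F phi) psi + ip (facev a i) (A F phi') psi.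
Proof. by move=> h h'; rewrite -[phi in LHS]scale1r ip_face_linear // mul1r. Qed.

Lemma ip_faceB (phi phi' psi : CPoly) : degle p phi -> degle p phi' ->
  ip (facev a i) (A F (phi - phi')) psi =
  ip (facev a i) (A F phi) psi - ip (facev a i) (A F phi') psi.
Proof. by move=> h h'; rewrite -scaleN1r addrC ip_face_linear // mulN1r addrC. Qed.

Lemma fformC (phi psi : CPoly) : degle p phi -> degle p psi -> fform phi psi = fform psi phi.
Proof.
case: hA => _ [_ [_ [sym _]]] h h'; rewrite /fform.
have := sym _ _ h h'; rewrite /ipF !ipE => ->.
by rewrite ip_conj Re_conjc.
Qed.

Lemma fformDl (phi phi' psi : CPoly) : degle p phi -> degle p phi' ->
  fform (phi + phi') psi = fform phi psi + fform phi' psi.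
Proof. by move=> h h'; rewrite /fform ip_faceD // Re_add. Qed.

Lemma fformBl (phi phi' psi : CPoly) : degle p phi -> degle p phi' ->
  fform (phi - phi') psi = fform phi psi - fform phi' psi.
Proof. by move=> h h'; rewrite /fform ip_faceB // Re_add Re_opp. Qed.

Lemma fformDr (phi psi psi' : CPoly) : degle p phi -> degle p psi -> degle p psi' ->
  fform phi (psi + psi') = fform phi psi + fform phi psi'.
Proof.
move=> h h1 h2; rewrite fformC ?fformDl ?(fformC _ h) //; exact: degleD.
Qed.

Lemma fformBr (phi psi psi' : CPoly) : degle p phi -> degle p psi -> degle p psi' ->
  fform phi (psi - psi') = fform phi psi - fform phi psi'.
Proof.
move=> h h1 h2; rewrite fformC ?fformBl ?(fformC _ h) //; exact: degleB.
Qed.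

Lemma fform_ge0 (phi : CPoly) : degle p phi -> 0 <= fform phi phi.
Proof.
case: hA => _ [ext [lin [_ [pos _]]]] h.
have [z|nz] := pselect (eqon F phi 0).
  rewrite /fform ip_conj Re_conjc (_ : ip _ phi _ = 0) // -(ip0 (facev a i) (A F phi)).
  exact: eq_ip.
by have := pos _ h nz; rewrite /ipF ipE ltcE => /andP[_ /ltW].
Qed.

Lemma fform_le0 (phi : CPoly) : degle p phi -> fform phi phi <= 0 -> eqon F phi 0.
Proof.
case: hA => _ [_ [_ [_ [pos _]]]] h le0; apply: contrapT => nz.
have := pos _ h nz; rewrite /ipF ipE ltcE => /andP[_] /=.
by rewrite ltNge; rewrite /fform in le0; rewrite le0.
Qed.

Lemma degle_Ainv (phi : CPoly) : degle p phi -> degle p (Ainv F phi).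
Proof. by case: hA => deg _ /deg []. Qed.

Lemma ip_face_inv (phi psi : CPoly) : degle p phi ->
  ip (facev a i) (A F (Ainv F phi)) psi = ip (facev a i) phi psi.
Proof. by case: hA => _ [_ [_ [_ [_ inv]]]] /inv [h _]; apply: eq_ip. Qed.

(** [A] sends [Ainv 0] to zero on the face, so the form vanishes at [Ainv 0] and definiteness
    concludes. *)
Lemma Ainv_eqon0 : eqon F (Ainv F 0) 0.
Proof.
apply: fform_le0; first by apply: degle_Ainv; exact: degle0.
by rewrite /fform ip_face_inv ?ip0 //; exact: degle0.
Qed.

End FaceForm.

(** Bookkeeping for the energy argument: [D1], [D2] stand for volume terms, [S1], [S2] for face
    terms, [T1], [T2] for data, and [X] for the boundary term of Green's formula. *)
Lemma energy_balance (R : realType) (D1 D2 X S1 S2 T1 T2 : R) :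
  - D1 + S1 = T1 -> - D2 + S2 = - T2 -> D1 + D2 = X -> 2 * (S1 + S2 - X - T1 + T2) = 0.
Proof. lra. Qed.

Lemma face_balance (R : realType) (tt tw ww gt gw : R) :
  tt + ww - gt + gw =
  2 * (2^-1 * (tt + tw) + 2^-1 * (tw + ww) - tw - 2^-1 * gt + 2^-1 * gw).
Proof. by field. Qed.

Lemma face_squares (R : realType) (tt tw ww gt gw gg : R) :
  tt + tw + (tw + ww) + (gg - (gt - gw) - (gt - (tt - tw) - (gw - (tw - ww)))) =
  gg + 2 * (tt + ww - gt + gw).
Proof. by ring. Qed.

(** If [g = x - y] on a face, the numerical flux is half the data plus a full trace; the data cancel
    and the trace is undone by Green's formula. *)
Lemma half_sub (C : numFieldType) (x y : C) : 2^-1 * (x + y) = 2^-1 * (x - y) + y.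
Proof. by field. Qed.

Lemma half_add (C : numFieldType) (x y : C) : 2^-1 * (x + y) = - (2^-1 * (x - y)) + x.
Proof. by field. Qed.

Lemma le_of_addr (R : realType) (x y z : R) : x + y = z -> 0 <= y -> x <= z.
Proof. by move=> <-; rewrite lerDl. Qed.

Lemma lt_of_addr (R : realType) (x y z : R) : x + y = z -> 0 < y -> x < z.
Proof. by move=> <-; rewrite ltrDl. Qed.

Lemma weak_residual1 (C : numFieldType) (k s D G : C) :
  - k - s + (G + (s + D)) = G -> D - k = 0.
Proof. by move=> h; apply: (addrI G); rewrite addr0 -[RHS]h; ring. Qed.

Lemma weak_residual2 (C : numFieldType) (k s D G : C) :
  - k - s + (- G + (s + D)) = - G -> D - k = 0.
Proof. exact: weak_residual1. Qed.

(** * The local problem on one element *)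

Section Local.
Context {R : realType} {n : nat}.
Local Notation C := R[i].
Local Notation d := n.+1.
Local Notation point := 'rV[R]_d.
Local Notation CPoly := {mpoly C[d]}.
Context (p : nat) (A Ainv : set point -> CPoly -> CPoly) (a : 'I_d.+1 -> point).
Context (kappa eta : R) (nu : 'I_d.+1 -> point) (g : 'I_d.+1 -> CPoly).
Context (pK : CPoly) (uK : 'I_d -> CPoly).
Context (a0 : Defs.nondegenerate a) (kappa_gt0 : 0 < kappa) (eta_gt0 : 0 < eta).
Context (hA : forall i, face_operator p A Ainv a i).
Context (hnu : forall i, unit_outward_normal a i (nu i)).
Context (hg : forall i, degle p (g i)).
Context (hsol : local_solution p A Ainv a kappa eta nu g pK uK).

Let F i := faceset a i.
Let tr i := Ainv (F i) pK.
Let w i := ndot (nu i) uK.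
Let ff i := fform A a i.

Let deg_pK : degle p pK. Proof. by case: hsol. Qed.
Let deg_uK j : degle p (uK j). Proof. by case: hsol => _ [h _]; exact: h. Qed.
Let deg_tr i : degle p (tr i). Proof. exact: degle_Ainv. Qed.
Let deg_w i : degle p (w i). Proof. exact: degle_ndot. Qed.
Let deg_r i : degle p (tr i - w i). Proof. exact: degleB. Qed.

Let ip_tr i psi : ip (facev a i) (A (F i) (tr i)) psi = ip (facev a i) pK psi.
Proof. exact: (ip_face_inv (hA i) psi deg_pK). Qed.

Lemma local_eq1 (q : CPoly) : degle p q ->
  - ('i%C * ((kappa / eta)%:C%C * ip a pK q)) - \sum_j ip a (uK j) (mderiv j q)
  + \sum_i 2^-1 * ip (facev a i) (tr i + w i) q
  = \sum_i 2^-1 * ip (facev a i) (g i) q.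
Proof.
case: hsol => _ [_ [h _]] hq; have := h q hq.
have -> : ipK a (fun x => real_complex R (kappa / eta) * ev pK x) (ev q) =
    (kappa / eta)%:C%C * ip a pK q.
  rewrite -ipZ -ipE; apply: eq_cint => x _.
  by rewrite /ev mevalZ.
have -> : ipKv a (fun j => ev (uK j)) (fun j => ev (dpoly j q)) =
    \sum_j ip a (uK j) (mderiv j q).
  rewrite /ip -cint_sum; apply: eq_cint => x _.
  rewrite {3}/ev raddf_sum; apply: eq_bigr => j _.
  by rewrite -[RHS]/(ev _ x) evM ev_conjP.
rewrite (eq_bigr (fun i => 2^-1 * ip (facev a i) (tr i + w i) q)) => [|i _]; last first.
  by rewrite /ipF ipE.
by rewrite [in RHS](eq_bigr (fun i => 2^-1 * ip (facev a i) (g i) q)) // => i _; rewrite /ipF ipE.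
Qed.

(** On faces [pK] is rewritten as [A (tr i)], so that every face term goes through [A]. *)
Lemma local_eq2 (v : 'I_d -> CPoly) : (forall j, degle p (v j)) ->
  - ('i%C * ((kappa * eta)%:C%C * \sum_j ip a (uK j) (v j))) - ip a pK (divpoly v)
  + \sum_i 2^-1 * (ip (facev a i) (A (F i) (tr i)) (ndot (nu i) v)
                   + ip (facev a i) (A (F i) (w i)) (ndot (nu i) v))
  = - \sum_i 2^-1 * ip (facev a i) (A (F i) (g i)) (ndot (nu i) v).
Proof.
case: hsol => _ [_ [_ h]] hv; have := h v hv.
have -> : ipKv a (fun j x => real_complex R (kappa * eta) * ev (uK j) x)
    (fun j => ev (v j)) = (kappa * eta)%:C%C * \sum_j ip a (uK j) (v j).
  rewrite mulr_sumr (eq_bigr (fun j => ip a ((kappa * eta)%:C%C *: uK j) (v j))); last first.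
    by move=> j _; rewrite ipZ.
  rewrite /ip -cint_sum; apply: eq_cint => x _.
  rewrite {3}/ev raddf_sum; apply: eq_bigr => j _.
  rewrite -[RHS]/(ev _ x) evM ev_conjP; congr (_ * _).
  by rewrite /ev mevalZ.
rewrite {1}/ipK ipE.
rewrite (eq_bigr (fun i => 2^-1 * (ip (facev a i) (A (F i) (tr i)) (ndot (nu i) v)
                   + ip (facev a i) (A (F i) (w i)) (ndot (nu i) v)))) => [|i _]; last first.
  by rewrite /ipF ipE ipD ip_tr.
rewrite [in RHS](eq_bigr (fun i => 2^-1 * ip (facev a i) (A (F i) (g i)) (ndot (nu i) v))) //.
by move=> i _; rewrite /ipF ipE.
Qed.

Lemma Re_half (z : C) : complex.Re (2^-1 * z) = 2^-1 * complex.Re z.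
Proof.
have -> : 2^-1 = (2^-1 : R)%:C%C :> C by rewrite fmorphV rmorph_nat.
by rewrite mulrC Re_mulr mulrC.
Qed.

Lemma Re_i_real (c : R) (z : C) : complex.Im z = 0 -> complex.Re ('i%C * (c%:C%C * z)) = 0.
Proof. by case: z => x y /= ->; rewrite !(mul0r, mulr0, addr0, subr0). Qed.

(** Test with [q = pK]: the mass term is purely imaginary and drops out of the real part, while
    [pK = A (tr i)] turns face products into [ff]. *)
Lemma energy_eq1 :
  - \sum_j complex.Re (ip a (uK j) (mderiv j pK)) + \sum_i 2^-1 * ff i (tr i) (tr i + w i)
  = \sum_i 2^-1 * ff i (tr i) (g i).
Proof.
have faceE i q : complex.Re (ip (facev a i) q pK) = ff i (tr i) q.
  by rewrite ip_conj Re_conjc /ff /fform ip_tr.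
have sumE (f : 'I_d.+1 -> CPoly) :
    complex.Re (\sum_i 2^-1 * ip (facev a i) (f i) pK) = \sum_i 2^-1 * ff i (tr i) (f i).
  by rewrite Re_sum; apply: eq_bigr => i _; rewrite Re_half faceE.
have := congr1 (@complex.Re R) (local_eq1 deg_pK).
rewrite [LHS]Re_add sumE sumE Re_add !Re_opp Re_sum.
by rewrite (Re_i_real _ (Im_ip_self a pK)) oppr0 add0r.
Qed.

Lemma energy_eq2 :
  - complex.Re (ip a pK (divpoly uK)) + \sum_i 2^-1 * (ff i (tr i) (w i) + ff i (w i) (w i))
  = - \sum_i 2^-1 * ff i (g i) (w i).
Proof.
have := congr1 (@complex.Re R) (local_eq2 deg_uK).
have Im0 : complex.Im (\sum_j ip a (uK j) (uK j)) = 0.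
  by rewrite Im_sum big1 // => j _; rewrite Im_ip_self.
rewrite !Re_add !Re_opp Re_i_real // oppr0 add0r !Re_sum.
rewrite (eq_bigr (fun i => 2^-1 * (ff i (tr i) (w i) + ff i (w i) (w i)))) => [|i _]; last first.
  by rewrite Re_half Re_add.
by move=> ->; congr (- _); apply: eq_bigr => i _; rewrite Re_half.
Qed.

Lemma energy_div :
  \sum_j complex.Re (ip a (uK j) (mderiv j pK)) + complex.Re (ip a pK (divpoly uK)) =
  \sum_i ff i (tr i) (w i).
Proof.
have := congr1 (@complex.Re R) (ip_grad_div a0 hnu uK pK).
rewrite Re_add !Re_sum (ip_conj a pK) Re_conjc => ->.
by apply: eq_bigr => i _; rewrite ip_conj Re_conjc /ff /fform ip_tr.
Qed.

Lemma energy_identity :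
  \sum_i ff i (tr i + w i) (tr i + w i)
  + \sum_i ff i (g i - (tr i - w i)) (g i - (tr i - w i)) = \sum_i ff i (g i) (g i).
Proof.
(* Twice this sum is exactly what separates the two squares of the identity from the square of
   [g]. *)
have E : \sum_i (ff i (tr i) (tr i) + ff i (w i) (w i) - ff i (g i) (tr i) + ff i (g i) (w i)) = 0.
  rewrite -[RHS](energy_balance energy_eq1 energy_eq2 energy_div).
  rewrite -big_split -!sumrB -big_split mulr_sumr; apply: eq_bigr => i _ /=.
  rewrite /ff (fformDr (hA i)) // (fformC (hA i) (deg_tr i) (hg i)).
  exact: face_balance.
transitivity (\sum_i (ff i (g i) (g i) + 2 * (ff i (tr i) (tr i) + ff i (w i) (w i)
    - ff i (g i) (tr i) + ff i (g i) (w i)))); last first.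
  by rewrite big_split -mulr_sumr E mulr0; exact: addr0.
rewrite -big_split; apply: eq_bigr => i _ /=; rewrite /ff.
rewrite (fformBl (hA i)) // (fformDl (hA i)) // (fformBl (hA i)) //.
rewrite !(fformBr (hA i)) // ?(fformDr (hA i)) //.
rewrite (fformC (hA i) (deg_tr i) (hg i)) (fformC (hA i) (deg_w i) (hg i)).
rewrite (fformC (hA i) (deg_w i) (deg_tr i)).
exact: face_squares.
Qed.

Lemma resonance_free : (forall i, eqon (F i) (g i) (tr i - w i)) -> pK = 0 /\ forall j, uK j = 0.
Proof.
move=> hgr.
have i0 : 'i%C != 0 :> C by rewrite eq_complex /= oner_eq0 andbF.
have k0 : (kappa)%:C%C != 0 :> C by rewrite -(rmorph0 (real_complex R)) (inj_eq (@complexI R)) gt_eqF.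
have e0 : (eta)%:C%C != 0 :> C by rewrite -(rmorph0 (real_complex R)) (inj_eq (@complexI R)) gt_eqF.
pose c1 : C := 'i%C * (kappa / eta)%:C%C; pose c2 : C := 'i%C * (kappa * eta)%:C%C.
(* The residual is orthogonal to all polynomials of degree at most [p] and is itself one of them, so
   testing it against itself shows that it is zero. *)
have strong1 : divpoly uK = c1 *: pK.
  have weak q : degle p q -> ip a (divpoly uK - c1 *: pK) q = 0.
    move=> hq; rewrite ipB ipZ; have := local_eq1 hq.
    have -> : \sum_i 2^-1 * ip (facev a i) (tr i + w i) q =
       \sum_i 2^-1 * ip (facev a i) (g i) q + \sum_i ip (facev a i) (ndot (nu i) uK) q.
      rewrite -big_split; apply: eq_bigr => i _ /=.
      by rewrite (eq_ip q (hgr i)) ipB ipD half_sub.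
    by rewrite -(ip_grad_div a0 hnu uK q) /c1 -mulrA; exact: weak_residual1.
  apply: subr0_eq; apply: (cint_norm_eq0 a0); rewrite -/(ip _ _ _) weak //.
  by apply: degleB; [exact: degle_divpoly|exact: degleZ].
have strong2 j : mderiv j pK = c2 *: uK j.
  have weak v : (forall j, degle p (v j)) -> \sum_j ip a (mderiv j pK - c2 *: uK j) (v j) = 0.
    move=> hv.
    have -> : \sum_j ip a (mderiv j pK - c2 *: uK j) (v j) =
        \sum_j ip a (mderiv j pK) (v j) - c2 * \sum_j ip a (uK j) (v j).
      by rewrite mulr_sumr -sumrB; apply: eq_bigr => l _; rewrite ipB ipZ.
    have := local_eq2 hv.
    have -> : \sum_i 2^-1 * (ip (facev a i) (A (F i) (tr i)) (ndot (nu i) v)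
                   + ip (facev a i) (A (F i) (w i)) (ndot (nu i) v)) =
       - \sum_i 2^-1 * ip (facev a i) (A (F i) (g i)) (ndot (nu i) v)
       + \sum_i ip (facev a i) pK (ndot (nu i) v).
      rewrite -sumrN -big_split; apply: eq_bigr => i _ /=.
      have -> : ip (facev a i) (A (F i) (g i)) (ndot (nu i) v) =
          ip (facev a i) (A (F i) (tr i - w i)) (ndot (nu i) v).
        (* [g] and [tr - w] agree only as traces; [A] respects this equality. *)
        by apply: eq_ip; case: (hA i) => _ [ext _]; exact: ext.
      by rewrite (ip_faceB (hA i)) // ip_tr half_add.
    rewrite -(ip_div_grad a0 hnu v pK) /c2 -mulrA; exact: weak_residual2.
  pose v j := mderiv j pK - c2 *: uK j.
  have hv j' : degle p (v j') by apply: degleB; [exact: degle_mderiv|exact: degleZ].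
  have := congr1 (@complex.Re R) (weak v hv); rewrite Re_sum => /eqP.
  rewrite psumr_eq0 => [/allP h|j' _]; last exact: cint_norm_ge0.
  apply: subr0_eq; apply: (cint_norm_eq0 a0).
  by apply/eqP; apply: h; rewrite mem_index_enum.
have p0 : pK = 0.
  (* Combining both strong equations gives the Helmholtz equation, with [c2 * c1 = - kappa^2]. *)
  apply: (@laplace_eigen_eq0 _ _ pK (c2 * c1)).
    by rewrite !mulf_neq0 // ?rmorphM ?fmorphV ?mulf_neq0 ?invr_neq0.
  rewrite -scalerA -strong1 /divpoly scaler_sumr; apply: eq_bigr => j _.
  by rewrite strong2 mderivZ.
split=> // j; have := strong2 j; rewrite p0 mderiv0 => /esym/eqP.
rewrite scaler_eq0 => /orP[|/eqP //].
by rewrite /c2 rmorphM !mulf_eq0 (negbTE i0) (negbTE k0) (negbTE e0).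
Qed.

Lemma local_le :
  \sum_i ff i (tr i + w i) (tr i + w i) <= \sum_i ff i (g i) (g i).
Proof.
apply: (le_of_addr energy_identity); apply: sumr_ge0 => i _.
by apply: (fform_ge0 (hA i)); apply: degleB.
Qed.

Lemma local_lt : (exists i, ~ eqon (F i) (g i) 0) ->
  \sum_i ff i (tr i + w i) (tr i + w i) < \sum_i ff i (g i) (g i).
Proof.
move=> [i0 hi0]; apply: (lt_of_addr energy_identity).
have dg i : degle p (g i - (tr i - w i)) by apply: degleB.
have pos i : 0 <= ff i (g i - (tr i - w i)) (g i - (tr i - w i)).
  exact: (fform_ge0 (hA i)).
rewrite lt_def sumr_ge0 // andbT; apply/negP; rewrite psumr_eq0 // => /allP h.
have hgr i : eqon (F i) (g i) (tr i - w i).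
  have : eqon (F i) (g i - (tr i - w i)) 0.
    apply: (fform_le0 (hA i)) => //.
    by move: (h i (mem_index_enum i)) => /eqP; rewrite /ff => ->.
  move=> z x hx; apply: subr0_eq; have := z x hx.
  by rewrite /ev mevalB meval0.
have [p0 u0] := resonance_free hgr.
(* With [pK] and [uK] zero, [g = tr - w] reduces to [Ainv 0] on the face, hence to zero there,
   against the choice of [i0]. *)
apply: hi0 => x hx; rewrite (hgr i0 x hx) /ev mevalB -!/(ev _ x) /tr p0.
rewrite (Ainv_eqon0 (hA i0) hx) /w /ndot big1 => [|j _]; last by rewrite u0 scaler0.
by rewrite subrr /ev meval0.
Qed.

End Local.

Lemma ltr_sqrt_sum (R : rcfType) (E : finType) (s g : E -> R) (K0 : E) :
  (forall K, 0 <= s K) -> (forall K, s K <= g K) -> s K0 < g K0 ->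
  Num.sqrt (\sum_K s K) < Num.sqrt (\sum_K g K).
Proof.
move=> s0 sg lt0; have SG : \sum_K s K < \sum_K g K.
  by rewrite (bigD1 K0) //= [X in _ < X](bigD1 K0) //=; apply: ltr_leD => //; apply: ler_sum.
by rewrite ltr_sqrt //; apply: le_lt_trans SG; apply: sumr_ge0.
Qed.

Theorem mainTheorem5 (R : realType) (n : nat)
    (hd : (n.+1 = 2 \/ n.+1 = 3)%N)
    (E : finType) (Om : set 'rV[R]_n.+1) (a : E -> 'I_n.+2 -> 'rV[R]_n.+1)
    (hOm : lipschitz_domain Om) (hmesh : simplicial_mesh Om a)
    (p : nat) (kappa eta : E -> R)
    (hkappa : forall K, 0 < kappa K) (heta : forall K, 0 < eta K)
    (A Ainv : set 'rV[R]_n.+1 -> CPoly R n -> CPoly R n)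
    (hA : forall K i, face_operator p A Ainv (a K) i)
    (nu : E -> 'I_n.+2 -> 'rV[R]_n.+1)
    (hnu : forall K i, unit_outward_normal (a K) i (nu K i))
    (g : E -> 'I_n.+2 -> CPoly R n) (hg : forall K i, degle p (g K i))
    (pK : E -> CPoly R n) (uK : E -> 'I_n.+1 -> CPoly R n)
    (hsol : forall K, local_solution p A Ainv (a K) (kappa K) (eta K)
                        (nu K) (g K) (pK K) (uK K))
    (hg0 : exists K i, ~ eqon (faceset (a K) i) (g K i) 0) :
  Gnorm A a (fun K i => Ainv (faceset (a K) i) (pK K) + ndot (nu K i) (uK K))
    < Gnorm A a g.
Proof.
have [nd _] := hmesh; have [K0 hK0] := hg0.
have GnormE f : Gnorm A a f = Num.sqrt (\sum_K \sum_i fform A (a K) i (f K i) (f K i)).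
  by congr Num.sqrt; apply: eq_bigr => K _; apply: eq_bigr => i _; rewrite /ipF ipE.
(* The squared norms split over elements: no element gains energy, and [K0], which carries nonzero
   data, loses some. *)
rewrite !GnormE; apply: (@ltr_sqrt_sum _ _ _ _ K0) => [K|K|].
- apply: sumr_ge0 => i _; apply: (fform_ge0 (hA K i)).
  have [dp [du _]] := hsol K.
  by apply: degleD; [exact: (degle_Ainv (hA K i))|exact: degle_ndot].
- exact: (local_le (nd K) (hA K) (hnu K) (hg K) (hsol K)).
- exact: (local_lt (nd K0) (hkappa K0) (heta K0) (hA K0) (hnu K0) (hg K0) (hsol K0) hK0).
Qed.
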